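(* Consider the multi-type TASEP $(\eta_t)_{t\ge 0}$ on $\mathbb{Z}$ with initial configuration $\eta_0(x)=-x$ for $x\le 0$ and $\eta_0(x)=-\infty$ for $x>0$. Let $L_1(t)$ be the type of the right-most particle (the leader) at time $t$, i.e. $L_1(t)=\eta_t(x^* )$ where $x^*=\max\{x\in\mathbb{Z}:\eta_t(x)\ne-\infty\}$. Then, as $t\to\infty$, $L_1(t)/\sqrt{t}$ converges in distribution to the probability measure on $\mathbb{R}$ with density $$\frac{1}{\sqrt{\pi}}\exp\left(-\frac{a^2}{4}\right)\mathbf{1}_{a\ge 0}\,da .$$
   Context: Multi-type TASEP: a continuous-time Markov process whose states are maps $\eta:\mathbb{Z}\to\mathbb{Z}\cup\{-\infty\}$. The value $\eta(x)=c\in\mathbb{Z}$ means that a particle of type $c$ is at position $x$; $\eta(x)=-\infty$ means that $x$ is empty (a hole). Each pair of neighboring sites $(x,x+1)$ carries an independent exponential clock of rate $1$. When the clock of $(x,x+1)$ rings, the values at $x$ and $x+1$ are swapped if $\eta(x)>\eta(x+1)$, and nothing happens otherwise. (The process is well defined by the standard graphical construction.) *)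

(* Defs.v *)
From HB Require Import structures.
From mathcomp Require Import all_boot all_order all_algebra.
From mathcomp Require Import all_classical all_reals all_analysis.
From mathcomp Require Import measurable_realfun.

Set Implicit Arguments.
Unset Strict Implicit.
Unset Printing Implicit Defensive.

Import Order.TTheory GRing.Theory Num.Theory.
Import numFieldNormedType.Exports.

Local Open Scope classical_set_scope.
Local Open Scope ring_scope.

(* [Some c] is a particle of type [c]; [None] is a hole, i.e. the value -oo. *)
Definition config := int -> option int.

(* The strict order on Z U {-oo}. *)
Definition type_lt (a b : option int) : bool :=
  match a, b with
  | None, Some _ => true
  | Some c, Some c' => c < c'
  | _, None => false
  end.

(* The effect on [e] of a ring of the clock of the pair (x, x + 1). *)
Definition ring_update (e : config) (x : int) : config := fun y =>
  if type_lt (e (x + 1)) (e x) then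
    if y == x then e (x + 1) else if y == x + 1 then e x else e y
  else e y.

(* [rings x] is the set of times at which the clock of (x, x + 1) rings.
   Together with [h 0], the two clauses determine [h] on [0, +oo[ as soon as
   the ring sets are locally finite, adjacent clocks never ring together, and
   up to any given time there are silent clocks arbitrarily far on both sides
   of the origin; all of this holds almost surely for Poisson clocks. *)
Definition graphical_construction (R : realType) (rings : int -> set R)
    (h : R -> config) : Prop :=
  (forall (x : int) (s t : R), 0 <= s -> s <= t ->
     (forall u, s < u <= t -> ~ rings (x - 1) u /\ ~ rings x u) ->
     h t x = h s x) /\
  (forall (x : int) (t : R), 0 < t -> rings x t ->
     \forall s \near t^'-,
       h t x = ring_update (h s) x x /\
       h t (x + 1) = ring_update (h s) x (x + 1)).

Definition step_config : config :=
  fun x => if x <= 0 then Some (- x) else None.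

(* The maximum of the set of occupied sites (0 if there is no maximum). *)
Definition leader_pos (e : config) : int :=
  xget 0 [set x | e x <> None /\ forall y, e y <> None -> y <= x].

Definition leader_type (e : config) : int := odflt 0 (e (leader_pos e)).

Section random_clocks.
Context (d : measure_display) (T : measurableType d) (R : realType).
Variable P : probability T R.

Definition mutually_independent (I : eqType) (X : I -> {RV P >-> R}) : Prop :=
  forall (J : seq I) (A : I -> set R), uniq J ->
    (forall i, measurable (A i)) ->
    P (\bigcap_(i in [set` J]) (X i @^-1` A i)) =
    (\prod_(i <- J) P (X i @^-1` A i))%E.

(* [tau x 0] is the time of the first ring of the clock of (x, x + 1), and
   [tau x n.+1] is the waiting time between its rings n and n.+1. *)
Definition exponential_clocks (tau : int -> nat -> {RV P >-> R}) : Prop :=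
  (forall x n (A : set R), measurable A ->
     distribution P (tau x n) A = exponential_prob 1 A) /\
  mutually_independent (fun xn : int * nat => tau xn.1 xn.2).

Definition ring_times (tau : int -> nat -> {RV P >-> R}) (w : T) (x : int) :
    set R :=
  [set t | exists n : nat, t = \sum_(i < n.+1) tau x i w].

Definition multi_type_TASEP (tau : int -> nat -> {RV P >-> R}) (e0 : config)
    (eta : R -> T -> config) : Prop :=
  (forall t x (c : option int), 0 <= t -> measurable [set w | eta t w x = c]) /\
  {ae P, forall w, eta 0 w = e0 /\
     graphical_construction (ring_times tau w) (fun t => eta t w)}.

(* Convergence of the distribution functions at the continuity points of the
   distribution function of [mu]. *)
Definition cvg_in_distribution (X : R -> T -> R)
    (mu : probability (measurableTypeR R) R) : Prop :=
  (\forall t \near +oo, measurable_fun [set: T] (X t)) /\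
  (forall x : R, {for x, continuous (fun r : R => mu `]-oo, r]%classic)} ->
     P [set w | X t w <= x] @[t --> +oo] --> mu `]-oo, x]%classic).

End random_clocks.

Definition limit_pdf (R : realType) (a : R) : R :=
  (Num.sqrt pi)^-1 * expR (- (a ^+ 2 / 4)) * \1_`[0, +oo[ a.

Definition limit_prob (R : realType) :=
  fun A => (\int[lebesgue_measure]_(a in A) (limit_pdf (a : R))%:E)%E.

Section limit_prob.
Variable R : realType.
Notation mu := (@lebesgue_measure R).

Lemma limit_pdf_ge0 (a : R) : 0 <= limit_pdf a.
Proof. by rewrite /limit_pdf !mulr_ge0// ?invr_ge0// expR_ge0. Qed.

Lemma limit_pdfE (a : R) :
  limit_pdf a = 2 * normal_pdf 0 (Num.sqrt 2) a * \1_`[0, +oo[ a.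
Proof.
rewrite /limit_pdf normal_pdfE ?gt_eqF ?sqrtr_gt0//.
rewrite /normal_peak /normal_fun subr0 sqr_sqrtr//.
have -> : 2 * pi *+ 2 = 2 ^+ 2 * pi :> R by rewrite -mulr_natr mulrAC expr2.
rewrite sqrtrM ?sqr_ge0// sqrtr_sqr ger0_norm// invfM !mulrA mulfV// mul1r.
by rewrite mulNr -(mulr_natr 2 2) -natrM.
Qed.

Lemma measurable_limit_pdf : measurable_fun [set: R] (@limit_pdf R).
Proof.
rewrite (_ : @limit_pdf R =
  fun a => 2 * normal_pdf 0 (Num.sqrt 2) a * \1_`[0, +oo[ a).
  apply: measurable_funM; last exact: measurable_indic.
  by apply: measurable_funM => //; exact: measurable_normal_pdf.
by apply/funext => a; rewrite limit_pdfE.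
Qed.

Lemma integral_limit_pdf : (\int[mu]_a (limit_pdf a)%:E = 1)%E.
Proof.
have s0 : Num.sqrt 2 != 0 :> R by rewrite gt_eqF ?sqrtr_gt0.
have mn : measurable_fun setT (fun a : R => (normal_pdf 0 (Num.sqrt 2) a)%:E).
  by apply/measurable_EFinP; exact: measurable_normal_pdf.
under eq_integral => a _ do
  rewrite limit_pdfE -mulrA EFinM.
rewrite ge0_integralZl//=; last 2 first.
- apply/measurable_EFinP/measurable_funM; last exact: measurable_indic.
  exact: measurable_normal_pdf.
- by move=> a _; rewrite lee_fin mulr_ge0// normal_pdf_ge0.
under eq_integral do rewrite EFinM.
rewrite -[RHS](integral_normal_pdf 0 (Num.sqrt 2)).
rewrite (ge0_symfun_integralT (@normal_pdf_ge0 _ 0 (Num.sqrt 2))); last 2 first.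
- exact: continuous_normal_pdf.
- by move=> a /=; rewrite !normal_pdfE// /normal_fun !subr0 sqrrN.
congr (_ * _)%E; rewrite [RHS]integral_mkcond -set_itvcy.
apply: eq_integral => a _.
by rewrite patchE indicE; case: ifP; rewrite ?mule1 ?mule0.
Qed.

Let limit_prob0 : limit_prob (R := R) set0 = 0%E.
Proof. by rewrite /limit_prob integral_set0. Qed.

Let limit_prob_ge0 A : (0 <= limit_prob (R := R) A)%E.
Proof. by apply: integral_ge0 => a _; rewrite lee_fin limit_pdf_ge0. Qed.

Let limit_prob_sigma_additive :
  semi_sigma_additive (@limit_prob R).
Proof.
move=> F mF tF mUF; rewrite /limit_prob ge0_integral_bigcup//=.
- apply: is_cvg_ereal_nneg_natsum_cond => n _ _.
  by apply: integral_ge0 => a _; rewrite lee_fin limit_pdf_ge0.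
- apply/measurable_EFinP/measurable_funTS; exact: measurable_limit_pdf.
- by move=> a _; rewrite lee_fin limit_pdf_ge0.
Qed.

HB.instance Definition _ := isMeasure.Build _ _ _
  (@limit_prob R) limit_prob0 limit_prob_ge0 limit_prob_sigma_additive.

Let limit_probT : limit_prob (R := R) [set: _] = 1%E.
Proof. exact: integral_limit_pdf. Qed.

HB.instance Definition _ :=
  @Measure_isProbability.Build _ _ R (@limit_prob R)
    limit_probT.

End limit_prob.

(* Main.v *)
(* The foremost particle of type at least k is never blocked, so it performs a
   rate one Poisson walk from -k; likewise the leader performs one from 0, with
   the clocks of the sites that it crosses.  Hence the leader has type at least
   k at time t if and only if these two walks have met before t.
     Follow the walks site by site: let S x and U x be the times at which the
   leader and the particle from -k reach x.  As long as they have not met, the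
   memoryless property makes S x.+1 - S x and U x.+1 - U x independent
   exponential times, up to the event that the walks meet at x.  If
   (1 - al) (1 - be) = 1, then al U + be S is the exponent of a martingale, and
   optional stopping yields E [exp (- ((1 - q)^2 / q) H)] = q^k for the meeting
   time H, with H infinite when the walks do not meet.
     For k ~ x sqrt t, this gives E [exp (- n u H / t)] --> exp (- x sqrt (n u)),
   which is E [exp (- n u x^2 / Z^2)] for Z distributed according to the limit
   law, because 2 phi(z) exp (- c^2 / z^2), with phi the normal density of
   variance 2, has the explicit antiderivative
   exp (- c) Phi(z - 2 c / z) + exp c Phi(z + 2 c / z).
   So the moments of the bounded variables exp (- u H / t) converge, and a
   polynomial approximation of a step function gives P (H <= t) --> P (Z > x). *)
From HB Require Import structures.
Require Import Defs.
From mathcomp Require Import all_boot all_order all_algebra.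
From mathcomp Require Import all_classical all_reals all_analysis.
From mathcomp Require Import measurable_realfun zify ring lra.

Import Order.TTheory GRing.Theory Num.Theory.
Import numFieldNormedType.Exports.

Local Open Scope classical_set_scope.
Local Open Scope ring_scope.

Set Implicit Arguments.
Unset Strict Implicit.
Unset Printing Implicit Defensive.

(** * The foremost particle of type at least k *)

(** Both walks read the same clocks, so the independence of their increments at a site [x] has to be
    extracted from a single clock. If the leader has left [x] when the other walk arrives, the
    second wait begins after the first has ended. Otherwise no ring of [x] separates the two
    arrivals, both walks leave together, and the remaining wait of the leader is again exponential
    from the arrival of the other walk on; this keeps the payoff at the meeting computable.
    Proceeding by sites instead of by time, each application of the memoryless property concerns one
    clock at one random time, and that time depends only on clocks further left. The boundary term
    of optional stopping vanishes because [al <= 0] and [U] dominates [S]: the exponential is at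
    most [expR (- lam * S)], whose mean decays geometrically in the number of sites. Evaluating the
    transform at the integer multiples of one [u] gives the moments of one bounded variable, so
    polynomials take the place of a continuity theorem for Laplace transforms. An infinite [H] makes
    this variable 0, and so contributes to no moment of positive order. *)

Lemma real_induction (R : realType) (Q : R -> Prop) :
  Q 0 ->
  (forall u, 0 <= u -> Q u -> \forall s \near u^'+, Q s) ->
  (forall u, 0 < u -> (forall s, 0 <= s -> s < u -> Q s) -> Q u) ->
  forall u, 0 <= u -> Q u.
Proof.
move=> Q0 Qr Ql u u0; apply: contrapT => nQu.
pose A := [set s : R | 0 <= s /\ ~ Q s].
have Alb : lbound A 0 by move=> s [].
have A0 : A !=set0 by exists u.
have hA : has_inf A by split => //; exists 0.
have i0 : 0 <= inf A by apply: lb_le_inf.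
have below s : 0 <= s -> s < inf A -> Q s.
  move=> s0 si; apply: contrapT => nQs.
  have : inf A <= s by apply: ge_inf; [exists 0|].
  by rewrite leNgt si.
have Qi : Q (inf A).
  move: i0; rewrite le_eqVlt => /predU1P[<- //|i0]; exact: Ql.
have [e /= e0 He] := Qr _ i0 Qi.
have [a [a0 nQa] ai] : exists2 a, A a & a < inf A + e.
  by apply: inf_adherent.
have ia : inf A <= a by apply: ge_inf; [exists 0|].
apply: nQa; move: ia; rewrite le_eqVlt => /predU1P[<- //|ia].
apply: He => //=; rewrite ltr0_norm ?subr_lt0//; lra.
Qed.

Section occupation.
Variables (R : realType) (rings : int -> set R) (nxt : int -> R -> R).
Variables (b : R -> int -> bool) (a : int) (U : nat -> R).
Hypothesis nxt_ring : forall (x : int) (u : R), 0 <= u -> rings x (nxt x u).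
Hypothesis lt_nxt : forall (x : int) (u : R), 0 <= u -> u < nxt x u.
Hypothesis nxt_le : forall (x : int) (u v : R), 0 <= u -> rings x v -> u < v -> nxt x u <= v.
Hypothesis rings_left : forall (x : int) (t : R), 0 < t ->
  \forall s \near t^'-, forall v : R, s < v < t -> ~ rings x v.
Hypothesis silent_clock : forall (t : R) (x : int),
  exists z : int, x < z /\ forall v : R, 0 < v <= t -> ~ rings z v.
Hypothesis b_still : forall (x : int) (s t : R), 0 <= s -> s <= t ->
  (forall u : R, s < u <= t -> ~ rings (x - 1) u /\ ~ rings x u) ->
  b t x = b s x.
Hypothesis b_ring : forall (x : int) (t : R), 0 < t -> rings x t ->
  \forall s \near t^'-,
    b t x = b s x && b s (x + 1) /\ b t (x + 1) = b s x || b s (x + 1).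
Hypothesis b_init : forall x, b 0 x = (x <= a).
Hypothesis U0 : U 0%N = 0.
Hypothesis US : forall n, U n.+1 = nxt (a + n%:Z) (U n).

Let U_ge0 n : 0 <= U n.
Proof.
elim: n => [|n IH]; first by rewrite U0.
by rewrite US (le_trans IH)// ltW// lt_nxt.
Qed.

Lemma near_block {F : set_system R} {FF : Filter F} (lo : int) (n : nat)
    (H : R -> int -> Prop) :
  (forall x, \forall s \near F, H s x) ->
  \forall s \near F, forall x, lo <= x -> x <= lo + n%:Z -> H s x.
Proof.
move=> FH.
have : \forall s \near F, forall i : 'I_n.+1, H s (lo + i%:Z).
  by apply: filter_forall => i; exact: FH.
apply: filterS => s Hs x lx xl.
have [k [kn ->]] : exists k : nat, (k < n.+1)%N /\ x = lo + k%:Z.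
  by exists `|x - lo|%N; lia.
exact: (Hs (Ordinal kn)).
Qed.

Let updates (t s : R) (y : int) :=
  [/\ ~ rings (y - 1) t -> ~ rings y t -> b t y = b s y,
      rings y t -> b t y = b s y && b s (y + 1) &
      rings (y - 1) t -> b t y = b s (y - 1) || b s y].

Let near_updates (t : R) (y : int) : 0 < t -> \forall s \near t^'-, updates t s y.
Proof.
move=> t0.
have h1 : \forall s \near t^'-, ~ rings (y - 1) t -> ~ rings y t -> b t y = b s y.
  have [r1|r1] := pselect (rings (y - 1) t).
    by near=> s => /(_ r1).
  have [r2|r2] := pselect (rings y t).
    by near=> s => _ /(_ r2).
  near=> s => _ _; apply: b_still.
  - by near: s; exact: nbhs_left_ge.
  - by near: s; exact: nbhs_left_le.
  move=> u /andP[su]; rewrite le_eqVlt => /predU1P[->//|ut]; split => ru.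
    suff : forall v : R, s < v < t -> ~ rings (y - 1) v by apply; [|exact: ru]; rewrite su.
    by near: s; exact: rings_left.
  suff : forall v : R, s < v < t -> ~ rings y v by apply; [|exact: ru]; rewrite su.
  by near: s; exact: rings_left.
have h2 : \forall s \near t^'-, rings y t -> b t y = b s y && b s (y + 1).
  have [r|r] := pselect (rings y t).
    by have := b_ring t0 r; apply: filterS => s [].
  by near=> s => /r.
have h3 : \forall s \near t^'-, rings (y - 1) t -> b t y = b s (y - 1) || b s y.
  have [r|r] := pselect (rings (y - 1) t).
    by have := b_ring t0 r; apply: filterS => s [_]; rewrite subrK => ->.
  by near=> s => /r.
by near=> s; split; near: s.
Unshelve. all: by end_near. Qed.

(** A silent clock is a wall: an empty site can only be filled from its left neighbor. The rings of
    all clocks together may have no first time, so there is no induction on events; real induction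
    on a finite block of sites replaces it, since [near_block] controls finitely many clocks near
    any time. *)
Let right_of_silent (t : R) (z : int) : a < z -> (forall v : R, 0 < v <= t -> ~ rings z v) ->
  forall s : R, 0 <= s -> s <= t -> forall y : int, z < y -> ~~ b s y.
Proof.
move=> az silent s s0 st y zy.
have [z' [yz' silent']] := silent_clock t y.
pose n := `|z' - z|%N.
have nE : z + n%:Z = z' by lia.
pose Q s := s <= t -> forall y : int, z < y -> y <= z' -> ~~ b s y.
suff : Q s by apply => //; exact: ltW.
move: s s0 {st}; apply: real_induction => [_ x zx _|u u0 Qu|u u0 Qu ut x zx xz'].
- by rewrite b_init -ltNge (lt_trans az).
- have : \forall s \near u^'+, forall x : int, z <= x -> x <= z' -> s < nxt x u.
    by rewrite -nE; apply: near_block => x; apply: nbhs_right_lt; exact: lt_nxt.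
  have := @nbhs_right_gt _ u; apply: filterS2 => s us sn st x zx xz'.
  rewrite (@b_still _ u)//; [by apply: Qu => //; rewrite (le_trans (ltW us))|exact: ltW|].
  move=> v /andP[uv vs]; split => rv.
    have : s < nxt (x - 1) u by apply: sn; clear -zx xz'; lia.
    by rewrite ltNge (le_trans _ vs)//; exact: nxt_le.
  have : s < nxt x u by apply: sn => //; exact: ltW.
  by rewrite ltNge (le_trans _ vs)//; exact: nxt_le.
- have : \forall s \near u^'-, [/\ 0 <= s, s < u & updates u s x].
    near=> s; split; near: s;
      [exact: nbhs_left_ge|exact: nbhs_left_lt|exact: near_updates].
  move=> /filter_ex[s [s0 su [nr r1 r2]]].
  have st : s <= t by rewrite (le_trans (ltW su)).
  have nbx : ~~ b s x by apply: Qu.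
  have [rx|rx] := pselect (rings x u); first by rewrite r1// (negbTE nbx).
  have [rx1|rx1] := pselect (rings (x - 1) u); last by rewrite nr.
  have : z != x - 1 by apply/eqP => zx1; apply: (silent u); rewrite ?u0//= zx1.
  rewrite r2// negb_or nbx andbT => zx1.
  by apply: Qu => //; [clear -zx zx1; lia|clear -xz'; lia].
Unshelve. all: by end_near. Qed.

(** Nothing stands to the right of the front, so it jumps at each ring of its own clock, while a
    ring just behind it leaves its site occupied. The clock of [z] is silent up to [t], so the front
    stays at or left of [z]; the bound [n <= N] confines the induction to a finite block, and
    [right_of_silent] takes care of the sites beyond [z]. *)
Lemma front_walk (t : R) : 0 <= t -> exists n : nat,
  [/\ U n <= t, t < U n.+1, b t (a + n%:Z) &
      forall y : int, a + n%:Z < y -> ~~ b t y].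
Proof.
move=> t0; have [z [az silent]] := silent_clock t a.
have [N zN] : exists N : nat, z = a + N%:Z by exists `|z - a|%N; lia.
pose Q s := s <= t -> exists n : nat,
  [/\ (n <= N)%N, U n <= s, s < U n.+1, b s (a + n%:Z) &
      forall y : int, a + n%:Z < y -> ~~ b s y].
suff QT (s : R) : 0 <= s -> Q s.
  by have [n [_ ? ? ? ?]] := QT t t0 (lexx t); exists n.
move: s; apply: real_induction => [_|u u0 Qu|u u0 Qu ut].
- exists 0%N; rewrite US U0 addr0 lt_nxt// b_init lexx; split => // y ay.
  by rewrite b_init -ltNge.
- have : \forall s \near u^'+, forall x : int, a - 1 <= x ->
      x <= a - 1 + N.+1%:Z -> s < nxt x u.
    by apply: near_block => x; apply: nbhs_right_lt; exact: lt_nxt.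
  have := @nbhs_right_gt _ u; apply: filterS2 => s us sn st.
  have still x : a <= x -> x <= z -> b s x = b u x.
    move=> ax xz; apply: b_still => //; first exact: ltW.
    move=> v /andP[uv vs]; split => rv.
      have : s < nxt (x - 1) u by apply: sn; clear -ax xz zN; lia.
      by rewrite ltNge (le_trans _ vs)//; exact: nxt_le.
    have : s < nxt x u by apply: sn; clear -ax xz zN; lia.
    by rewrite ltNge (le_trans _ vs)//; exact: nxt_le.
  have [n [nN Un Un1 bn nb]] := Qu (le_trans (ltW us) st).
  exists n; split => //.
  + by rewrite (le_trans Un) ?ltW.
  + have : s < nxt (a + n%:Z) u by apply: sn; clear -nN; lia.
    move=> /lt_le_trans; apply; apply: nxt_le => //.
    by rewrite US; exact: nxt_ring.
  + by rewrite still//; clear -nN zN; lia.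
  + move=> y ny; have [yz|zy] := leP y z; last first.
      by apply: (@right_of_silent t z) => //; rewrite (le_trans u0) ?ltW.
    by rewrite still//; [exact: nb|clear -ny; lia].
- have : \forall s \near u^'-, [/\ 0 <= s, s < u,
      forall x : int, a - 1 <= x -> x <= a - 1 + N.+2%:Z -> updates u s x &
      forall x : int, a - 1 <= x -> x <= a - 1 + N.+2%:Z ->
        forall v : R, s < v < u -> ~ rings x v].
    near=> s; split; near: s;
      [exact: nbhs_left_ge|exact: nbhs_left_lt|apply: near_block|apply: near_block].
      by move=> x; exact: near_updates.
    by move=> x; exact: rings_left.
  move=> /filter_ex[s [s0 su upd noring]].
  have st : s <= t by rewrite (le_trans (ltW su)).
  have [n [nN Un Un1 bn nb]] := Qu s s0 su st.
  have uU : u <= U n.+1.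
    rewrite leNgt; apply/negP => Uu.
    apply: (noring (a + n%:Z)) (U n.+1) _ _; [clear -nN; lia|clear -nN; lia| |].
      by rewrite Un1.
    by rewrite US; exact: nxt_ring.
  have znr : ~ rings z u by apply: silent; rewrite u0.
  have nz : rings (a + n%:Z) u -> (n < N)%N.
    move=> rn; rewrite ltn_neqAle nN andbT; apply/eqP => nN'.
    by apply: znr; rewrite zN -nN'.
  have [rn|rn] := pselect (rings (a + n%:Z) u).
  + have nN1 := nz rn.
    have Uu : U n.+1 = u.
      by apply/eqP; rewrite eq_le uU andbT US; apply: nxt_le => //; exact: le_lt_trans su.
    exists n.+1; rewrite Uu; split => //.
    * by rewrite US Uu lt_nxt// ltW.
    * have [_ _] : updates u s (a + n.+1%:Z) by apply: upd; clear -nN1; lia.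
      have -> : a + n.+1%:Z - 1 = a + n%:Z by clear; lia.
      by move=> ->//; rewrite bn.
    * move=> y ny; have [yz|zy] := leP y z; last first.
        by apply: (@right_of_silent t z) => //; exact: ltW.
      have nby : ~~ b s y by apply: nb; clear -ny; lia.
      have [h1 h2 h3] : updates u s y by apply: upd; clear -ny yz zN; lia.
      have [ry|ry] := pselect (rings y u); first by rewrite h2// (negbTE nby).
      have [ry1|ry1] := pselect (rings (y - 1) u); last by rewrite h1.
      by rewrite h3// negb_or nby andbT; apply: nb; clear -ny; lia.
  + have Uu : u < U n.+1.
      rewrite lt_neqAle uU andbT; apply/eqP => uE; apply: rn.
      by rewrite uE US; exact: nxt_ring.
    exists n; split => //.
    * by rewrite (le_trans Un)// ltW.
    * have [h1 h2 h3] : updates u s (a + n%:Z) by apply: upd; clear -nN; lia.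
      have [ry1|ry1] := pselect (rings (a + n%:Z - 1) u); last by rewrite h1.
      by rewrite h3// bn orbT.
    * move=> y ny; have [yz|zy] := leP y z; last first.
        by apply: (@right_of_silent t z) => //; exact: ltW.
      have nby : ~~ b s y by exact: nb.
      have [h1 h2 h3] : updates u s y by apply: upd; clear -ny yz zN; lia.
      have [ry|ry] := pselect (rings y u); first by rewrite h2// (negbTE nby).
      have [ry1|ry1] := pselect (rings (y - 1) u); last by rewrite h1.
      rewrite h3// negb_or nby andbT; apply: nb.
      have yn : y - 1 != a + n%:Z by apply/eqP => E; apply: rn; rewrite -E.
      by clear -ny yn; lia.
Unshelve. all: by end_near. Qed.

End occupation.

(** * The next ring of a single clock *)

Section one_clock.
Variables (R : realType) (f : nat -> R).

Definition arrival (n : nat) : R := \sum_(i < n) f i.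

Definition first_after (u : R) (n : nat) : Prop :=
  (forall i, (i < n)%N -> arrival i.+1 <= u) /\ u < arrival n.+1.

(** The default [u] keeps [next_ring] monotone and above its argument for an arbitrary [f]. This
    matters because positivity and unboundedness of the ring times hold only almost surely, whereas
    measurability is proved over all sample points. *)
Definition next_ring (u : R) : R :=
  if pselect (exists n, u < arrival n.+1) is left h
  then arrival (ex_minn h).+1 else u.

(** The next ring after [u] as far as the first [n] waiting times reveal it; the value [u] signals
    that none of these [n] rings comes after [u]. *)
Fixpoint next_ringn (n : nat) (u : R) : R :=
  if n is m.+1 then
    if u < next_ringn m u then next_ringn m u else Num.max u (arrival n)
  else u.

Lemma next_ringE (u : R) (n : nat) :
  first_after u n -> next_ring u = arrival n.+1.
Proof.
move=> [un nu]; rewrite /next_ring; case: pselect => [h|[]]; last by exists n.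
case: ex_minnP => m um mmin; congr (arrival _.+1); apply/eqP.
rewrite eqn_leq (mmin _ nu) leqNgt; apply/negP => mn.
by have := un _ mn; rewrite leNgt um.
Qed.

Lemma next_ringP (u : R) :
  (exists2 n, first_after u n & next_ring u = arrival n.+1) \/
  (forall n, arrival n.+1 <= u) /\ next_ring u = u.
Proof.
have [h|h] := pselect (exists n, u < arrival n.+1).
  left; have [n un nmin] := ex_minnP h.
  suff un' : first_after u n by exists n => //; exact: next_ringE.
  by split=> // i ni; rewrite leNgt; apply/negP => /nmin; rewrite leqNgt ni.
right; split; last by rewrite /next_ring; case: pselect.
by move=> n; rewrite leNgt; apply/negP => un; apply: h; exists n.
Qed.

Lemma next_ring_ge (u : R) : u <= next_ring u.
Proof. by have [[n [_ un] ->]|[_ ->//]] := next_ringP u; exact: ltW. Qed.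

Lemma next_ring_le (u v : R) : u <= v -> next_ring u <= next_ring v.
Proof.
move=> uv.
have [[n [un nu] ->]|[_ ->]] := next_ringP u; last first.
  exact: le_trans (next_ring_ge _).
have [[m [vm mv] ->]|[+ ->]] := next_ringP v; last exact.
case: (ltngtP n m) => [nm|mn|-> //].
  by rewrite (le_trans (vm _ nm))// ltW.
by have := un _ mn; rewrite leNgt (le_lt_trans uv).
Qed.

Lemma next_ringnP (n : nat) (u : R) :
  (forall i, (i < n)%N -> arrival i.+1 <= u) /\ next_ringn n u = u \/
  exists m, [/\ (m < n)%N, first_after u m & next_ringn n u = arrival m.+1].
Proof.
elim: n => [|n IH] /=; first by left.
case: IH => [[un ->]|[m [mn um ->]]].
  rewrite ltxx; have [nu|un1] := ltP u (arrival n.+1); last first.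
    left; split => // i; rewrite ltnS leq_eqVlt => /predU1P[->//|]; exact: un.
  by right; exists n.
by right; exists m; case: (um) => _ ->; rewrite (ltn_trans mn).
Qed.

Lemma first_after_inj (u : R) (m n : nat) :
  first_after u m -> first_after u n -> m = n.
Proof.
move=> [um mu] [un nu]; case: (ltngtP m n) => // [/un|/um]; rewrite leNgt.
  by rewrite mu.
by rewrite nu.
Qed.

(** When exactly the first [n] rings precede [u], these [n] waiting times decide whether a walk that
    arrived at time [s] has left by time [u], and when. This is what makes the past of the leader
    measurable at the time the other walk arrives. *)
Lemma next_ringn_before (s u : R) (n : nat) : s <= u -> first_after u n ->
  (next_ring s <= u) = (s < next_ringn n s) /\
  (s < next_ringn n s -> next_ring s = next_ringn n s) /\
  (u < next_ring s -> next_ring u = next_ring s).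
Proof.
move=> su un; have [[sn ->]|[m [mn sm ->]]] := next_ringnP n s.
  have sn' : first_after s n by split=> //; apply: le_lt_trans su un.2.
  by rewrite (next_ringE sn') (next_ringE un) ltxx leNgt un.2.
by rewrite (next_ringE sm) sm.2 (un.1 _ mn); split=> //; split=> //;
  rewrite ltNge (un.1 _ mn).
Qed.

Hypothesis f_gt0 : forall n, 0 < f n.
Hypothesis arrival_unbounded : forall u, exists n, u < arrival n.+1.

Lemma arrival_lt (m n : nat) : (m < n)%N -> arrival m < arrival n.
Proof.
apply: (homo_ltn (r := fun x y : R => x < y)); first exact: lt_trans.
by move=> i; rewrite /arrival big_ord_recr/= ltrDl.
Qed.

Lemma arrival_ltE (m n : nat) : (arrival m < arrival n) = (m < n)%N.
Proof.
have [mn|nm] := ltnP m n; first exact: arrival_lt.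
rewrite leq_eqVlt in nm; case/predU1P: nm => [->|nm]; first by rewrite ltxx.
by apply/negbTE; rewrite -leNgt ltW// arrival_lt.
Qed.

Lemma first_afterP (u : R) : exists n, first_after u n.
Proof.
have [[n un _]|[h _]] := next_ringP u; first by exists n.
by have [n] := arrival_unbounded u; rewrite ltNge h.
Qed.

Lemma next_ring_arrival (u : R) : exists n, next_ring u = arrival n.+1.
Proof. by have [n /next_ringE ->] := first_afterP u; exists n. Qed.

Lemma next_ring_gt (u : R) : u < next_ring u.
Proof. by have [n un] := first_afterP u; rewrite (next_ringE un); case: un. Qed.

Lemma next_ring_min (u : R) (n : nat) : u < arrival n.+1 ->
  next_ring u <= arrival n.+1.
Proof.
have [m um] := first_afterP u; rewrite (next_ringE um) => un.
rewrite leNgt arrival_ltE; apply/negP => nm.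
by have := um.1 _ nm; rewrite leNgt un.
Qed.

Lemma near_arrival (t : R) : 0 < t ->
  \forall s \near t^'-, forall v : R, s < v < t -> ~ exists n, v = arrival n.+1.
Proof.
move=> t0; have [n [nt tn]] := first_afterP t.
have : \forall s \near t^'-, forall i : 'I_n.+1, arrival i.+1 < t -> arrival i.+1 < s.
  apply: filter_forall => i; have [it|ti] := ltP (arrival i.+1) t; last first.
    by near=> s.
  by apply: filterS (nbhs_left_gt it).
apply: filterS => s sn v /andP[sv vt] [m vm].
have mn : (m < n.+1)%N.
  by have := lt_trans vt tn; rewrite vm arrival_ltE => /ltnW.
by have := sn (Ordinal mn); rewrite /= -vm => /(_ vt); rewrite ltNge (ltW sv).
Unshelve. all: by end_near. Qed.

End one_clock.

(** * The two walks and their meeting *)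

Fixpoint walk (R : realType) (f : int -> nat -> R) (a : int) (n : nat) : R :=
  if n is m.+1 then next_ring (f (a + m%:Z)) (walk f a m) else 0.

Lemma walk_ge0 (R : realType) (f : int -> nat -> R) (a : int) (n : nat) :
  0 <= walk f a n.
Proof. by elim: n => //= n /le_trans; apply; exact: next_ring_ge. Qed.

(* The walks followed by the foremost particle among all of them, and by the
   foremost one among those of type at least [k]; [lead f x] and
   [chase f k x] are the times at which they reach the site [x]. *)
Definition lead (R : realType) (f : int -> nat -> R) (x : nat) : R := walk f 0 x.
Definition chase (R : realType) (f : int -> nat -> R) (k x : nat) : R :=
  walk f (- k%:Z) (k + x)%N.

Section walks.
Variables (R : realType) (f : int -> nat -> R).

Lemma leadS (x : nat) : lead f x.+1 = next_ring (f x%:Z) (lead f x).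
Proof. by rewrite /lead /= add0r. Qed.

Lemma chaseS (k x : nat) :
  chase f k x.+1 = next_ring (f x%:Z) (chase f k x).
Proof. by rewrite /chase addnS /=; congr (next_ring (f _) _); lia. Qed.

Lemma lead_chase (k x : nat) : lead f x <= chase f k x.
Proof.
elim: x => [|x IH]; first exact: walk_ge0.
by rewrite leadS chaseS next_ring_le.
Qed.

(** No meeting at a site left of [x]: the leader has gone from each such site [y >= 0] when the
    other walk arrives. A tie counts as gone. *)
Definition apart (k x : nat) : Prop :=
  forall y, (y < x)%N -> lead f y.+1 <= chase f k y.

Definition meet (k x : nat) : Prop := apart k x /\ chase f k x < lead f x.+1.

(** The clock of [x] does not ring between the two arrivals, so both walks wait for the same
    ring. *)
Lemma meet_same (k x : nat) : meet k x -> chase f k x.+1 = lead f x.+1.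
Proof.
move=> [_ mx]; have := lead_chase k x.
have [[n xn E]|[h E]] := next_ringP (f x%:Z) (lead f x); last first.
  by rewrite leadS E in mx; rewrite leNgt mx.
rewrite chaseS leadS; rewrite leadS E in mx => lc; rewrite E.
by apply: next_ringE; split => // i ni; rewrite (le_trans (xn.1 _ ni)).
Qed.

(** The right-hand side says that both walks are at [x] at time [t]. Once they have met they stay
    together, so the first site that the leader has not left by time [t] serves as [x]; [far]
    provides such a site. Conversely, the least site where the other walk catches the leader is the
    meeting site, and it is reached no later than [x]. *)
Lemma meet_beforeP (k : nat) (t : R) : (forall x, exists n, t < lead f (x + n)%N) ->
  (exists x, meet k x /\ chase f k x <= t) <->
  (exists x, chase f k x <= t /\ t < lead f x.+1).
Proof.
move=> far; split=> [[x [mx xt]]|[x [xt tx]]].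
  have same y : chase f k (x + y).+1 = lead f (x + y).+1.
    elim: y => [|y IH]; last by rewrite addnS chaseS IH [RHS]leadS.
    by rewrite addn0; exact: meet_same.
  have [txl|lxt] := ltP t (lead f x.+1); first by exists x.
  have ex : exists n, t < lead f (x + n).+2.
    by have [n tn] := far x.+2; exists n; rewrite -!addSn.
  have [n tn nmin] := ex_minnP ex.
  exists (x + n).+1; split => //; rewrite same leNgt; apply/negP.
  case: n tn nmin => [_ _|n tn nmin]; first by rewrite addn0 ltNge lxt.
  by rewrite addnS => /nmin; rewrite ltnn.
have ex : exists x, chase f k x < lead f x.+1.
  by exists x; exact: le_lt_trans tx.
have [y my ymin] := ex_minnP ex; exists y; split.
  split => // z zy; rewrite leNgt; apply/negP => /ymin; rewrite leqNgt.
  by rewrite zy.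
have yx : (y <= x)%N by apply: ymin; exact: le_lt_trans tx.
apply: le_trans xt; rewrite -(subnKC yx); elim: (x - y)%N => [|n IH].
  by rewrite addn0.
by rewrite addnS chaseS (le_trans IH)// next_ring_ge.
Qed.

End walks.

Section front.
Variables (R : realType) (f : int -> nat -> R) (h : R -> config).
Hypothesis f_gt0 : forall x n, 0 < f x n.
Hypothesis f_unbounded : forall x u, exists n, u < arrival (f x) n.+1.
Hypothesis f_silent : forall (t : R) (x : int), exists2 z, x < z & t < f z 0%N.
Hypothesis hgc : graphical_construction
  (fun x => [set t | exists n : nat, t = \sum_(i < n.+1) f x i]) h.
Hypothesis h0 : h 0 = step_config.

(** An upward closed set of types projects the process to a TASEP with a single type: a ring leaves
    the smaller value on the left and the larger one on the right, which under [p] become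
    conjunction and disjunction. *)
Lemma front_config (p : pred (option int)) (a : int) (t : R) :
  (forall c c', type_lt c c' -> p c -> p c') ->
  (forall x, p (step_config x) = (x <= a)) -> 0 <= t ->
  exists n : nat, [/\ walk f a n <= t, t < walk f a n.+1,
    p (h t (a + n%:Z)) & forall y, a + n%:Z < y -> ~~ p (h t y)].
Proof.
move=> p_mono p_step; case: hgc => still ring.
apply: (@front_walk _ (fun x => [set t | exists n, t = arrival (f x) n.+1])
  (fun x => next_ring (f x)) (fun t x => p (h t x))) => //.
- by move=> x u _; exact: next_ring_arrival.
- by move=> x u _; exact: next_ring_gt.
- by move=> x u v _ [n ->]; exact: next_ring_min.
- by move=> x u; exact: near_arrival.
- move=> u x; have [z xz uz] := f_silent u x; exists z; split => // v /andP[_ vu].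
  move=> [n vn]; have := le_lt_trans vu uz; rewrite vn.
  by rewrite (_ : f z 0%N = arrival (f z) 1) ?arrival_ltE// /arrival big_ord1.
- by move=> x s u s0 su nr; rewrite (still _ s).
- move=> x u u0 xu; have := ring _ _ u0 xu; apply: filterS => s [-> ->].
  rewrite /ring_update !eqxx.
  have -> : (x + 1 == x) = false by clear; lia.
  have nt c c' : ~~ type_lt c c' -> p c' -> p c.
    case: c c' => [c|] [c'|] //=; last by move=> _; exact: p_mono.
    by rewrite -leNgt le_eqVlt => /predU1P[->//|cc']; exact: p_mono.
  case: ifPn => [lt|/nt nlt].
    have := p_mono _ _ lt.
    by case: (p (h s x)); case: (p (h s (x + 1))) => // /(_ isT).
  by move: nlt; case: (p (h s x)); case: (p (h s (x + 1))) => // /(_ isT).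
- by move=> x; rewrite h0 p_step.
Qed.

(** Apply [front_config] to all particles and to those of type at least [k]. The leader belongs to
    the second class exactly when the two fronts are at the same site, that is when the second walk
    is [k] jumps ahead of the first: [m = k + n]. *)
Lemma leader_type_ge (k : nat) (t : R) : 0 <= t ->
  (k%:Z <= leader_type (h t)) <->
  exists x, chase f k x <= t /\ t < lead f x.+1.
Proof.
move=> t0; pose isS (c : option int) := c != None.
pose ge (c : option int) := if c is Some i then k%:Z <= i else false.
have [||n [Sn nS hn nh]] := @front_config isS 0 t _ _ t0.
- by move=> [c|] [c'|].
- by move=> x; rewrite /isS /step_config; case: ifP.
have [||m [Um mU hm mh]] := @front_config ge (- k%:Z) t _ _ t0.
- by move=> [c|] [c'|]//= cc' /le_trans; apply; exact: ltW.
- by move=> x; rewrite /ge /step_config; case: ifP; lia.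
rewrite add0r in hn nh.
have -> : leader_type (h t) = odflt 0 (h t n%:Z).
  rewrite /leader_type; congr (odflt 0 (h t _)); rewrite /leader_pos.
  apply: xget_unique => [|z [hz zmax]].
    split; first exact/eqP.
    move=> y hy; rewrite leNgt; apply/negP => /nh; rewrite /isS.
    by rewrite negbK => /eqP.
  apply/eqP; rewrite eq_le zmax ?andbT; last exact/eqP.
  rewrite leNgt; apply/negP => /nh; rewrite /isS negbK => /eqP; exact: hz.
have -> : (k%:Z <= odflt 0 (h t n%:Z)) = ge (h t n%:Z).
  by move: hn; rewrite /isS /ge; case: (h t _).
have mn : (m <= k + n)%N.
  rewrite leqNgt; apply/negP => nm.
  have /nh : n%:Z < - k%:Z + m%:Z by lia.
  by rewrite /isS; move: hm; rewrite /ge; case: (h t _).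
have mono j : walk f (- k%:Z) j <= walk f (- k%:Z) j.+1 by exact: next_ring_ge.
have walk_mono (a : int) i j : (i <= j)%N -> walk f a i <= walk f a j.
  move=> ij; rewrite -(subnKC ij); elim: (j - i)%N => [|l IH].
    by rewrite addn0.
  by rewrite addnS (le_trans IH)// next_ring_ge.
split=> [gen|[x [Ux xS]]].
  have km : m = (k + n)%N.
    apply/eqP; rewrite eqn_leq mn leqNgt; apply/negP => mlt.
    have : - k%:Z + m%:Z < n%:Z by clear -mlt; lia.
    by move=> /mh; rewrite gen.
  by exists n; rewrite /chase -km.
have xn : (n <= x)%N.
  rewrite leqNgt; apply/negP => nx; have := walk_mono 0 _ _ nx.
  by rewrite leNgt (le_lt_trans Sn xS).
have kxm : (k + x <= m)%N.
  rewrite leqNgt; apply/negP => mx; have := walk_mono (- k%:Z) _ _ mx.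
  by rewrite leNgt (le_lt_trans Ux mU).
have mE : m = (k + n)%N by lia.
by move: hm; rewrite mE (_ : - k%:Z + _ = n%:Z)//; clear; lia.
Qed.

(** A site whose clock first rings after [t] cannot be left by time [t]. *)
Lemma lead_unbounded (t : R) (x : nat) : exists n, t < lead f (x + n)%N.
Proof.
have [z xz tz] := f_silent t x%:Z.
exists (`|z|.+1 - x)%N; rewrite subnKC; last lia.
rewrite leadS (_ : `|z|%N%:Z = z); last lia.
have [n ->] := next_ring_arrival (f_unbounded z) (lead f `|z|%N).
apply: lt_le_trans tz _; rewrite leNgt.
by rewrite (_ : f z 0%N = arrival (f z) 1) ?arrival_ltE// /arrival big_ord1.
Qed.

End front.

(** * Independence of the clocks *)

(** The density [p] agrees almost everywhere with the Radon-Nikodym derivative of [nu], for which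
    the change of variables is known. *)
Lemma ge0_integral_density d (T : measurableType d) (R : realType)
    (mu : {sigma_finite_measure set T -> \bar R})
    (nu : {finite_measure set T -> \bar R}) (p : T -> R) (f : T -> \bar R) :
  (forall x, 0 <= p x) -> mu.-integrable [set: T] (EFin \o p) ->
  (forall A, measurable A -> nu A = \int[mu]_(x in A) (p x)%:E)%E ->
  (forall x, 0 <= f x)%E -> measurable_fun [set: T] f ->
  (\int[nu]_x f x = \int[mu]_x (f x * (p x)%:E))%E.
Proof.
move=> p0 ip nuE f0 mf.
have numu : nu `<< mu.
  apply/null_content_dominatesP => A mA muA0; rewrite nuE//.
  rewrite -(@integral_abs_eq0 _ _ _ mu A (EFin \o p) mA _ muA0).
    by apply: eq_integral => x _ /=; rewrite ger0_norm.
  by apply: measurable_funTS; exact: measurable_int ip.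
rewrite -(Radon_Nikodym_SigmaFinite.change_of_variables numu)//.
apply: ge0_ae_eq_integral => //.
- apply: emeasurable_funM => //.
  exact: measurable_int (Radon_Nikodym_SigmaFinite.f_integrable numu).
- by apply: emeasurable_funM => //; exact: measurable_int ip.
- by move=> x _; rewrite mule_ge0// Radon_Nikodym_SigmaFinite.f_ge0.
- by move=> x _; rewrite mule_ge0// lee_fin.
apply: filterS (_ : ae_eq mu setT (Radon_Nikodym_SigmaFinite.f nu mu) (EFin \o p)).
  by move=> x /(_ I) /= ->.
apply: integral_ae_eq => //.
- exact: Radon_Nikodym_SigmaFinite.f_integrable.
- exact: measurable_int ip.
- move=> A _ mA; rewrite -Radon_Nikodym_SigmaFinite.f_integral//.
  exact: nuE.
Qed.

(** Memorylessness in integrated form: [expR (- u)] is the probability of surviving [u], and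
    [(1 - g)^-1] is the exponential moment of a fresh waiting time. *)
Lemma integral_exponential_tail d (T : measurableType d) (R : realType)
    (P : probability T R) (X : {RV P >-> R}) (g u : R) :
  (forall A : set R, measurable A -> distribution P X A = exponential_prob 1 A) ->
  g < 1 -> 0 <= u ->
  (\int[distribution P X]_x (expR (g * (x - u)) * (u < x)%R%:R)%:E =
   ((1 - g)^-1 * expR (- u))%:E)%E.
Proof.
move=> XE g1 u0.
(* [lebesgue_measure] lives on [measurableTypeR R], not on [R] itself. *)
have mX : measurable_fun [set: T] (X : T -> measurableTypeR R).
  by move=> _ A mA; exact: (measurable_funP X measurableT A mA).
have mX' := isMeasurableFun.Build _ _ _ _ _ mX.
pose Y : {mfun T >-> measurableTypeR R} := HB.pack (X : T -> measurableTypeR R) mX'.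
pose E : probability (measurableTypeR R) R := distribution P Y.
have EE (A : set (measurableTypeR R)) : measurable A -> E A = exponential_prob 1 A.
  exact: XE.
have g1' : 0 < 1 - g by rewrite subr_gt0.
pose F := fun x : R => - ((1 - g)^-1 * expR (g * (x - u) - x)).
pose G := fun x : R => expR (g * (x - u) - x).
have dlin (x : R) : is_derive x 1 (fun x => g * (x - u) - x) (g - 1).
  by apply: is_derive_eq; rewrite -?[_ *: _]/(_ * _); ring.
have dF (x : R) : is_derive x 1 F (G x).
  rewrite /F /G; apply: is_derive_eq; rewrite -?[_ *: _]/(_ * _).
  by field; rewrite gt_eqF.
have cG : continuous G.
  move=> x; apply: continuous_comp; last exact: continuous_expR.
  by apply/differentiable_continuous/derivable1_diffP; case: (dlin x).
have cF (x : R) : {for x, continuous F}.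
  by apply/differentiable_continuous/derivable1_diffP; case: (dF x).
have mf : measurable_fun [set: R]
    (fun x : R => (expR (g * (x - u)) * (u < x)%R%:R)%:E).
  apply/measurable_EFinP/measurable_funM.
    apply: measurableT_comp => //; apply: measurable_funM => //.
    exact: measurable_funB.
  by apply: measurableT_comp => //; exact: measurable_fun_ltr.
have f0 (x : R) : (0 <= (expR (g * (x - u)) * (u < x)%R%:R)%:E)%E.
  by rewrite lee_fin mulr_ge0// expR_ge0.
rewrite ge0_integral_distribution//.
rewrite -[LHS](@ge0_integral_distribution _ _ _ (measurableTypeR R) _ P Y _ mf f0).
have ip := @integrable_exponential_pdf R 1 ltr01.
rewrite (@ge0_integral_density _ _ _ lebesgue_measure _ _ _
  (@exponential_pdf_ge0 R 1 ler01) ip EE f0 mf).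
transitivity (\int[lebesgue_measure]_(x in `[u, +oo[) (G x)%:E)%E.
  rewrite -integral_itv_obnd_cbnd; last first.
    by apply/measurable_EFinP/measurable_funTS; exact: continuous_measurable_fun.
  rewrite [RHS]integral_mkcond; apply: eq_integral => x _.
  rewrite patchE; case: ifPn => [|/negP]; rewrite inE/= in_itv/= andbT.
    move=> ux; rewrite ux mulr1 exponential_pdfE// ?(le_trans u0) ?ltW//.
    by rewrite mul1r -EFinM -expRD; congr (expR _)%:E; rewrite mulN1r.
  by move=> /negP/negbTE ->; rewrite mulr0 mul0e.
rewrite (@ge0_continuous_FTC2y _ G F _ 0).
- by rewrite sub0e /F -EFinN opprK subrr mulr0 sub0r.
- by move=> x _; exact: expR_ge0.
- exact/continuous_subspaceT.
- rewrite -oppr0 /F; apply: cvgN; rewrite -(mulr0 (1 - g)^-1); apply: cvgM.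
    exact: cvg_cst.
  rewrite (_ : (fun x => _) = (fun x => expR (- (g * u)) * expR (- ((1 - g) * x)))).
    rewrite -(mulr0 (expR (- (g * u)))); apply: cvgM; first exact: cvg_cst.
    apply: (@cvg_comp _ _ _ (fun x => (1 - g) * x) (fun z => expR (- z)) _ (pinfty_nbhs R)).
      exact: gt0_cvgMry.
    exact: cvgr_expR.
  by apply/funext => x; rewrite -expRD; congr expR; ring.
- by move=> x _; case: (dF x).
- exact/cvg_at_right_filter/cF.
- by move=> x _; rewrite derive1E; case: (dF x).
Qed.

(** * Sigma-algebras generated by families of waiting times *)

Section known.
Context d (T : measurableType d) (R : realType) (P : probability T R).
Context (I : choiceType) (X : I -> {RV P >-> R}).

Definition cylinders (D : set I) : set (set T) :=
  [set C | exists (J : seq I) (A : I -> set R),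
     [/\ uniq J, [set` J] `<=` D, forall i, measurable (A i) &
         C = \bigcap_(i in [set` J]) (X i @^-1` A i)]].

(** A copy of [T] with the sigma-algebra generated by the [X i], [i] in [D]. Being known from [D]
    becomes plain measurability on this copy, so the usual closure lemmas apply to it. *)
Definition info (D : set I) : Type := g_sigma_algebraType (cylinders D).

HB.instance Definition _ (D : set I) := Measurable.on (info D).

Lemma measurable_infoE (D : set I) (A : set T) :
  measurable (A : set (info D)) = <<s cylinders D >> A.
Proof. by []. Qed.

Lemma cylinders_measurable (D : set I) : cylinders D `<=` measurable.
Proof.
move=> _ [J [A [uJ JD mA ->]]]; rewrite bigcap_seq; apply: bigsetI_measurable.
by move=> i _; rewrite -[X in measurable X]setTI; exact: measurable_funP.
Qed.

Lemma sub_cylinders (D1 D2 : set I) : D1 `<=` D2 -> cylinders D1 `<=` cylinders D2.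
Proof.
move=> D12 _ [J [A [uJ JD mA ->]]]; exists J, A; split => //.
exact: subset_trans D12.
Qed.

Lemma cylindersI (D : set I) : setI_closed (cylinders D).
Proof.
move=> _ _ [J1 [A1 [uJ1 JD1 mA1 ->]]] [J2 [A2 [uJ2 JD2 mA2 ->]]].
exists (undup (J1 ++ J2)), (fun i => (if i \in J1 then A1 i else setT) `&`
  (if i \in J2 then A2 i else setT)); split.
- exact: undup_uniq.
- by move=> i /=; rewrite mem_undup mem_cat => /orP[/JD1|/JD2].
- by move=> i; apply: measurableI; case: ifP.
- apply/seteqP; split => [w [w1 w2] i /= _|w Hw].
    by split; case: ifPn => // iJ; [exact: w1|exact: w2].
  split => i /= iJ.
    by have := Hw i; rewrite /= mem_undup mem_cat iJ => /(_ isT)[].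
  by have := Hw i; rewrite /= mem_undup mem_cat iJ orbT => /(_ isT)[].
Qed.

Lemma cylindersT (D : set I) : cylinders D setT.
Proof.
exists [::], (fun=> setT); split => //.
by apply/seteqP; split => // w _ i.
Qed.

Lemma info_measurable (D : set I) (A : set T) :
  measurable (A : set (info D)) -> measurable A.
Proof.
rewrite measurable_infoE; apply: smallest_sub.
  exact: sigma_algebra_measurable.
exact: cylinders_measurable.
Qed.

Lemma sub_info_measurable (D1 D2 : set I) (A : set T) : D1 `<=` D2 ->
  measurable (A : set (info D1)) -> measurable (A : set (info D2)).
Proof.
move=> D12; rewrite !measurable_infoE; apply: sub_smallest2r.
  exact: smallest_sigma_algebra.
exact: sub_cylinders.
Qed.

Definition known (D : set I) d' (T' : measurableType d') (f : T -> T') : Prop :=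
  measurable_fun [set: info D] (f : info D -> T').

Lemma known_measurable (D : set I) d' (T' : measurableType d') (f : T -> T') :
  known D f -> measurable_fun [set: T] f.
Proof.
by move=> kf _ A mA; apply: (@info_measurable D); exact: kf.
Qed.

Lemma sub_known (D1 D2 : set I) d' (T' : measurableType d') (f : T -> T') :
  D1 `<=` D2 -> known D1 f -> known D2 f.
Proof. by move=> D12 kf _ A mA; apply: (sub_info_measurable D12); exact: kf. Qed.

Lemma known_var (D : set I) (i : I) : D i -> known D (X i).
Proof.
move=> Di _ A mA; apply: sub_sigma_algebra; exists [:: i], (fun=> A); split => //.
  by move=> j /=; rewrite inE => /eqP ->.
rewrite setTI; apply/seteqP; split => [w wA j|w]; first by rewrite /= inE => /eqP ->.
by apply; rewrite /= inE.
Qed.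

Hypothesis Xind : mutually_independent X.

(** Cylinders form a pi-system on which mutual independence gives the product formula. With one
    event fixed, both sides are finite measures in the other, so the formula extends to one
    sigma-algebra and afterwards to the second. *)
Lemma info_independent (D1 D2 : set I) (A B : set T) :
  D1 `&` D2 = set0 -> measurable (A : set (info D1)) ->
  measurable (B : set (info D2)) -> (P (A `&` B) = P A * P B)%E.
Proof.
move=> D12.
have gen C1 C2 : cylinders D1 C1 -> cylinders D2 C2 ->
    (P (C1 `&` C2) = P C1 * P C2)%E.
  move=> [J1 [A1 [uJ1 JD1 mA1 ->]]] [J2 [A2 [uJ2 JD2 mA2 ->]]].
  have J12 i : i \in J1 -> i \in J2 -> False.
    move=> iJ1 iJ2; suff : (set0 : set I) i by [].
    by rewrite -D12; split; [exact: JD1|exact: JD2].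
  rewrite !Xind//.
  pose B1 i := if i \in J1 then A1 i else A2 i.
  rewrite (_ : _ `&` _ = \bigcap_(i in [set` (J1 ++ J2)]) (X i @^-1` B1 i)).
    rewrite Xind.
    - rewrite big_cat/=; congr (_ * _)%E; rewrite big_seq [RHS]big_seq.
        by apply: eq_bigr => i iJ; rewrite /B1 iJ.
      apply: eq_bigr => i iJ; rewrite /B1; case: ifPn => // iJ1.
      by case: (J12 i).
    - rewrite cat_uniq uJ1 uJ2 andbT /=; apply/hasPn => i iJ2; apply/negP => iJ1.
      exact: (J12 i).
    - by move=> i; rewrite /B1; case: ifP.
  apply/seteqP; split => [w [w1 w2] i /=|w Hw].
    rewrite mem_cat /B1 => /orP[iJ|iJ]; first by rewrite iJ; exact: w1.
    by case: ifPn => [iJ1|_]; [case: (J12 i)|exact: w2].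
  split => i /= iJ.
    by have := Hw i; rewrite /= /B1 mem_cat iJ; exact.
  have := Hw i; rewrite /= /B1 mem_cat iJ orbT; case: ifPn => [iJ1|_]; last exact.
  by case: (J12 i).
have scale (C : set T) : measurable C ->
    exists k : {nonneg R}, P C = (k%:num)%:E.
  move=> mC; exists (NngNum (fine_ge0 (measure_ge0 P C))).
  by rewrite /= fineK// fin_num_measure.
have half C2 : cylinders D2 C2 -> forall A, measurable (A : set (info D1)) ->
    (P (A `&` C2) = P A * P C2)%E.
  move=> cC2 {}A mA; have mC2 := cylinders_measurable cC2.
  have [k kE] := scale C2 mC2.
  transitivity (mscale k P A); last by rewrite /mscale/= muleC -kE.
  apply: (g_sigma_algebra_measure_unique (cylinders D1) _ (fun=> setT)
    _ _ (mrestr P mC2) (mscale k P)) => //.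
  - exact: cylinders_measurable.
  - by move=> _; exact: cylindersT.
  - by rewrite bigcup_const.
  - exact: cylindersI.
  - by move=> C1 cC1; rewrite /mscale/= /mrestr gen// kE muleC.
  - by move=> _; rewrite /mrestr; apply: le_lt_trans (ltry 1);
      apply: probability_le1; rewrite setTI.
move=> mA mB; have mA' := info_measurable mA.
have [k kE] := scale A mA'.
rewrite setIC; transitivity (mscale k P B); last by rewrite /mscale/= -kE.
apply: (g_sigma_algebra_measure_unique (cylinders D2) _ (fun=> setT)
    _ _ (mrestr P mA') (mscale k P)) => //.
- exact: cylinders_measurable.
- by move=> _; exact: cylindersT.
- by rewrite bigcup_const.
- exact: cylindersI.
- by move=> C2 cC2; rewrite /mscale/= /mrestr setIC half// kE.
- by move=> _; rewrite /mrestr; apply: le_lt_trans (ltry 1);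
    apply: probability_le1; rewrite setTI.
Qed.

(** The pair has a product law, so Fubini integrates [X i] out with [Y] frozen. *)
Lemma ge0_integral_independent (D : set I) (i : I) d' (T' : measurableType d')
    (Y : T -> T') (g : T' * R -> \bar R) :
  ~ D i -> known D Y -> measurable_fun [set: T' * R] g ->
  (forall z, 0 <= g z)%E ->
  (\int[P]_w g (Y w, X i w) =
   \int[P]_w \int[distribution P (X i)]_x g (Y w, x))%E.
Proof.
move=> Di kY mg g0.
have mY := known_measurable kY.
have mY' := isMeasurableFun.Build _ _ _ _ _ mY.
pose Y' : {RV P >-> T'} := HB.pack Y mY'.
have mYX : measurable_fun [set: T] (fun w => (Y w, X i w)).
  exact: measurable_fun_pair.
transitivity (\int[pushforward P (fun w => (Y w, X i w))]_z g z)%E.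
  by rewrite ge0_integral_pushforward.
transitivity (\int[distribution P Y' \x distribution P (X i)]_z g z)%E.
  apply: eq_measure_integral => C mC _; apply/esym.
  apply: product_measure_unique => // A B mA mB.
  apply: (@info_independent D [set i] (Y @^-1` A) (X i @^-1` B)).
  - by apply/seteqP; split => // j [Dj ji]; apply: Di; rewrite -ji.
  - by have := kY measurableT A mA; rewrite setTI.
  - have ki : known [set i] (X i) by exact: known_var.
    by have := ki measurableT B mB; rewrite setTI.
rewrite fubini_tonelli1// ge0_integral_distribution//.
  by apply: measurable_fun_fubini_tonelli_F.
by move=> y; exact: integral_ge0.
Qed.

End known.

Lemma measurable_set_ltr d (T : measurableType d) (R : realType) (f g : T -> R) :
  measurable_fun [set: T] f -> measurable_fun [set: T] g ->
  measurable [set x | f x < g x].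
Proof.
move=> mf mg; have := measurable_fun_ltr mf mg.
by move=> /(_ measurableT [set true]); rewrite setTI; exact.
Qed.

Lemma measurable_set_ler d (T : measurableType d) (R : realType) (f g : T -> R) :
  measurable_fun [set: T] f -> measurable_fun [set: T] g ->
  measurable [set x | f x <= g x].
Proof.
move=> mf mg; have := measurable_fun_ler mf mg.
by move=> /(_ measurableT [set true]); rewrite setTI; exact.
Qed.

Lemma ae_forallz d (T : measurableType d) (R : realType)
    (mu : {measure set T -> \bar R}) (Q : int -> T -> Prop) :
  (forall z, {ae mu, forall w, Q z w}) -> {ae mu, forall w, forall z, Q z w}.
Proof.
move=> aeQ; have : {ae mu, forall w, forall k, Q (Posz k) w /\ Q (Negz k) w}.
  by apply: ae_foralln => k; apply: filterI; exact: aeQ.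
by apply: filterS => w Hw [k|k]; case: (Hw k).
Qed.

Section clocks.
Context d (T : measurableType d) (R : realType) (P : probability T R).
Variable tau : int -> nat -> {RV P >-> R}.

Let X (xn : int * nat) : {RV P >-> R} := tau xn.1 xn.2.

Definition clock (x : int) (w : T) : nat -> R := fun n => tau x n w.

Lemma known_arrival (D : set (int * nat)) (x : int) (n : nat) :
  (forall i, (i < n)%N -> D (x, i)) ->
  known X D (fun w => arrival (clock x w) n).
Proof.
elim: n => [|n IH] Dx.
  by under eq_fun do rewrite /arrival big_ord0; exact: measurable_cst.
under eq_fun do rewrite /arrival big_ord_recr.
apply: measurable_funD; first by apply: IH => i /ltnW; exact: Dx.
have : known X D (X (x, n)) by apply: known_var; exact: Dx.
exact.
Qed.

Lemma known_all_before (D : set (int * nat)) (x : int) (n : nat) (V : T -> R) :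
  (forall i, (i < n)%N -> D (x, i)) -> known X D V ->
  measurable ([set w | forall i, (i < n)%N -> arrival (clock x w) i.+1 <= V w]
    : set (info X D)).
Proof.
move=> Dx kV.
rewrite (_ : mkset _ = \bigcap_(i in `I_n) [set w | arrival (clock x w) i.+1 <= V w])//.
apply: bigcap_measurableType => i ni.
apply: measurable_set_ler => //.
by apply: known_arrival => j ji; apply: Dx; exact: leq_trans ni.
Qed.

Lemma known_first_after (D : set (int * nat)) (x : int) (n : nat) (V : T -> R) :
  (forall i, (i <= n)%N -> D (x, i)) -> known X D V ->
  measurable ([set w | first_after (clock x w) (V w) n] : set (info X D)).
Proof.
move=> Dx kV; apply: measurableI.
  by apply: known_all_before => // i /ltnW; exact: Dx.
apply: measurable_set_ltr => //.
by apply: known_arrival => i; rewrite ltnS; exact: Dx.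
Qed.

Lemma known_next_ring (D : set (int * nat)) (x : int) (V : T -> R) :
  (forall n, D (x, n)) -> known X D V ->
  known X D (fun w => next_ring (clock x w) (V w)).
Proof.
move=> Dx kV.
pose E n : set (info X D) := [set w | first_after (clock x w) (V w) n].
have mE n : measurable (E n) by exact: known_first_after.
(* Piece [0] is the event without any later ring, where [next_ring] takes its default value. *)
pose F n : set (info X D) := if n is m.+1 then E m else ~` \bigcup_m E m.
have mF n : measurable (F n).
  by case: n => [|n] /=; [apply: measurableC; exact: bigcup_measurable|exact: mE].
rewrite /known; have -> : [set: info X D] = \bigcup_n F n.
  apply/esym; rewrite -subTset => w _.
  have [[n En]|nE] := pselect (exists n, E n w); first by exists n.+1.
  by exists 0%N => // -[n _ En]; apply: nE; exists n.
apply/measurable_fun_bigcup => // -[|n].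
  apply: (eq_measurable_fun (V : info X D -> R)); last exact: measurable_funTS.
  move=> w; rewrite inE => /= nE.
  by have [[n En]|[_ ->//]] := next_ringP (clock x w) (V w); case: nE; exists n.
apply: (eq_measurable_fun (fun w : info X D => arrival (clock x w) n.+1)).
  by move=> w; rewrite inE => /= /next_ringE ->.
by apply: measurable_funTS; apply: known_arrival.
Qed.

Lemma known_next_ringn (D : set (int * nat)) (x : int) (n : nat) (V : T -> R) :
  (forall i, (i < n)%N -> D (x, i)) -> known X D V ->
  known X D (fun w => next_ringn (clock x w) n (V w)).
Proof.
move=> + kV; elim: n => [//|n IH] Dx /=.
have kn : known X D (fun w => next_ringn (clock x w) n (V w)).
  by apply: IH => i ni; apply: Dx; exact: ltnW.
apply: measurable_fun_ifT => //; first exact: measurable_fun_ltr.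
by apply: measurable_maxr => //; exact: known_arrival.
Qed.

Hypothesis tau_exp : exponential_clocks tau.

Lemma clock_le (x : int) (n : nat) (c : R) : 0 <= c ->
  P [set w | tau x n w <= c] = (1 - expR (- c))%:E.
Proof.
move=> c0; have mgt : measurable `]c, +oo[%classic by exact: measurable_itv.
have -> : [set w | tau x n w <= c] = ~` (tau x n @^-1` `]c, +oo[).
  by apply/seteqP; split => w /=; rewrite in_itv/= andbT leNgt => /negP.
rewrite probability_setC; last exact: measurable_funPTI.
have := integral_exponential_tail (tau_exp.1 x n) (@ltr01 R) c0.
rewrite subr0 invr1 mul1r EFinB => <-; congr (1 - _)%E.
transitivity (\int[distribution P (tau x n)]_u (\1_(`]c, +oo[%classic) u)%:E)%E.
  by rewrite integral_indic// setIT.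
apply: eq_integral => u _; rewrite mul0r expR0 mul1r indicE.
by rewrite mem_setE in_itv/= andbT.
Qed.

(** Any [m] of these independent variables are all at most [c] with probability
    [(1 - expR (- c)) ^+ m]. The injection [i_] covers both uses: the successive waiting times of
    one clock, and the first rings of different clocks. *)
Lemma ae_clock_gt (i_ : nat -> int * nat) (c : R) : injective i_ -> 0 <= c ->
  {ae P, forall w, forall N, exists2 n, (N <= n)%N & c < X (i_ n) w}.
Proof.
move=> i_inj c0; apply: ae_foralln => N.
pose B := \bigcap_(n in [set n | (N <= n)%N]) [set w | X (i_ n) w <= c].
have mle n : measurable [set w | X (i_ n) w <= c].
  exact: measurable_set_ler.
have mB : measurable B by apply: bigcap_measurableType.
have q0 : 0 <= 1 - expR (- c) by rewrite subr_ge0 -expR0 ler_expR lerNl oppr0.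
have q1 : 1 - expR (- c) < 1 by rewrite gtrBl expR_gt0.
have Bq m : (P B <= ((1 - expR (- c)) ^+ m)%:E)%E.
  pose J := [seq i_ n | n <- iota N m].
  have mJ : measurable (\bigcap_(i in [set` J]) (X i @^-1` `]-oo, c]%classic)).
    apply: fin_bigcap_measurable => // i _.
    by rewrite -[X in measurable X]setTI; exact: measurable_funP.
  apply: (@le_trans _ _ (P (\bigcap_(i in [set` J]) (X i @^-1` `]-oo, c]%classic)))).
    apply: le_measure; rewrite ?inE//.
    move=> w Bw i /= /mapP[n]; rewrite mem_iota => /andP[Nn _] ->.
    by rewrite in_itv/=; exact: (Bw n Nn).
  rewrite (tau_exp.2 J (fun=> `]-oo, c]%classic))//; last first.
    by rewrite map_inj_uniq// iota_uniq.
  rewrite big_map (eq_bigr (fun=> (1 - expR (- c))%:E)); last first.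
    move=> n _; rewrite -(clock_le (i_ n).1 (i_ n).2 c0).
    by congr (P _); apply/seteqP; split => w /=; rewrite in_itv.
  rewrite prodEFin lee_fin big_const_seq count_predT size_iota.
  by rewrite iter_mulr_1.
exists B; split => //; last first.
  move=> w /= nw n Nn; rewrite /= leNgt; apply/negP => cX; apply: nw.
  by exists n.
apply/eqP; rewrite eq_le measure_ge0 andbT.
have cq : (((1 - expR (- c)) ^+ m)%:E @[m --> \oo] --> 0)%E.
  by apply: cvg_EFin; [near=> m|apply: cvg_expr; rewrite ger0_norm].
rewrite -(cvg_lim _ cq)//; apply: lime_ge; first exact: (cvgP _ cq).
by near=> m.
Unshelve. all: by end_near. Qed.

(** Infinitely many waiting times above 1 on each clock make its ring times unbounded; arbitrarily
    late first rings far to the right give the silent clocks. *)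
Lemma ae_clock_good : {ae P, forall w,
  [/\ forall x n, 0 < clock x w n,
      forall x (u : R), exists n, u < arrival (clock x w) n.+1 &
      forall (t : R) (x : int), exists2 z, x < z & t < clock z w 0%N]}.
Proof.
have pos : {ae P, forall w, forall x n, 0 < clock x w n}.
  apply: ae_forallz => x; apply: ae_foralln => n.
  exists [set w | tau x n w <= 0]; split.
  - exact: measurable_set_ler.
  - by have := clock_le x n (lexx 0); rewrite oppr0 expR0 subrr.
  - by move=> w /= /negP; rewrite -leNgt.
have big : {ae P, forall w, forall x N, exists2 n, (N <= n)%N & 1 < clock x w n}.
  apply: ae_forallz => x; apply: (@ae_clock_gt (fun n => (x, n))) => //.
  by move=> m n [].
have silent : {ae P, forall w, forall m N,
    exists2 n, (N <= n)%N & m%:R < clock n%:Z w 0%N}.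
  by apply: ae_foralln => m; apply: (@ae_clock_gt (fun n => (n%:Z, 0%N))) => // i j [].
apply: filterS3 pos big silent => w wpos wbig wsilent; split => // [x u|t x].
- have arr m : exists n, m%:R < arrival (clock x w) n.+1.
    elim: m => [|m [n mn]].
      by exists 0%N; rewrite /arrival big_ord1.
    have [k nk ck] := wbig x n.+1; exists k.
    rewrite /arrival big_ord_recr/= -natr1 ltrD// (lt_le_trans mn)//.
    rewrite -/(arrival _ k) leNgt arrival_ltE// -leqNgt.
    exact: nk.
  have [n un] := arr (Num.bound `|u|); exists n.
  apply: le_lt_trans un; rewrite (le_trans (ler_norm _))// ltW//.
  exact: archi_boundP.
- have [n xn tn] := wsilent (Num.bound `|t|) `|x|.+1.
  exists n%:Z; first lia.
  apply: le_lt_trans tn; rewrite (le_trans (ler_norm _))// ltW//.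
  exact: archi_boundP.
Qed.

(** Integrating [tau x n] out turns the left-hand side into the mean of [Z * expR (- W)] times
    [(1 - g)^-1]. The same computation with exponent 0 identifies that mean with the integral on the
    right. *)
Lemma stop_indep (D : set (int * nat)) (x : int) (n : nat) (W Z : T -> R) (g : R) :
  ~ D (x, n) -> known X D W -> known X D Z -> (forall w, 0 <= W w) ->
  (forall w, 0 <= Z w) -> g < 1 ->
  (\int[P]_w (Z w * (expR (g * (tau x n w - W w)) * (W w < tau x n w)%R%:R))%:E =
   (1 - g)^-1%:E * \int[P]_w (Z w * (W w < tau x n w)%R%:R)%:E)%E.
Proof.
move=> Dx kW kZ W0 Z0 g1.
have key (c : R) : c < 1 ->
  (\int[P]_w (Z w * (expR (c * (tau x n w - W w)) * (W w < tau x n w)%R%:R))%:E =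
   \int[P]_w (Z w * ((1 - c)^-1 * expR (- W w)))%:E)%E.
  move=> c1.
  (* The absolute value makes [h] nonnegative on the whole product space; it does not change [Z]. *)
  pose h (z : (R * R) * R) : \bar R :=
    (`|z.1.2| * (expR (c * (z.2 - z.1.1)) * (z.1.1 < z.2)%R%:R))%:E.
  have mh : measurable_fun [set: (R * R) * R] h.
    have m11 : measurable_fun [set: (R * R) * R] (fun z => z.1.1).
      exact: (measurableT_comp measurable_fst measurable_fst).
    have m12 : measurable_fun [set: (R * R) * R] (fun z => z.1.2).
      exact: (measurableT_comp measurable_snd measurable_fst).
    apply/measurable_EFinP/measurable_funM.
      by apply: measurableT_comp => //; exact: measurable_normr.
    apply: measurable_funM.
      apply: measurableT_comp => //; apply: measurable_funM => //.
      exact: measurable_funB measurable_snd m11.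
    by apply: measurableT_comp => //; exact: measurable_fun_ltr m11 measurable_snd.
  have h0 z : (0 <= h z)%E by rewrite lee_fin !mulr_ge0// expR_ge0.
  have kWZ : known X D (fun w => (W w, Z w)) by exact: measurable_fun_pair.
  transitivity (\int[P]_w h ((W w, Z w), X (x, n) w))%E.
    by apply: eq_integral => w _; rewrite /h/= ger0_norm.
  rewrite (ge0_integral_independent tau_exp.2 Dx kWZ mh h0).
  apply: eq_integral => w _; rewrite /h/= ger0_norm//.
  under eq_integral do rewrite EFinM.
  rewrite ge0_integralZl//=.
  - by rewrite (integral_exponential_tail (tau_exp.1 x n)).
  - apply/measurable_EFinP/measurable_funM.
      apply: measurableT_comp => //; apply: measurable_funM => //.
      exact: measurable_funB.
    by apply: measurableT_comp => //; exact: measurable_fun_ltr.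
  - by rewrite lee_fin Z0.
have mW := known_measurable kW.
have mZ := known_measurable kZ.
have mZW : measurable_fun [set: T] (fun w => (Z w * expR (- W w))%:E).
  apply/measurable_EFinP/measurable_funM => //.
  by apply: measurableT_comp => //; exact: measurable_funN.
rewrite key//.
under eq_integral do rewrite mulrCA EFinM.
rewrite ge0_integralZl//; last 2 first.
- by move=> w _; rewrite lee_fin mulr_ge0// expR_ge0.
- by rewrite lee_fin invr_ge0 subr_ge0 ltW.
congr (_ * _)%E; transitivity (\int[P]_w (Z w * ((1 - 0)^-1 * expR (- W w)))%:E)%E.
  by apply: eq_integral => w _; rewrite subr0 invr1 mul1r.
by rewrite -key//; apply: eq_integral => w _; rewrite mul0r expR0 mul1r.
Qed.

End clocks.

(** * The strong Markov property of one clock at a random time *)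

Section memoryless.
Context d (T : measurableType d) (R : realType) (P : probability T R).
Variable tau : int -> nat -> {RV P >-> R}.
Hypothesis tau_exp : exponential_clocks tau.

Let X (xn : int * nat) : {RV P >-> R} := tau xn.1 xn.2.

Variables (D : set (int * nat)) (x : int) (V : T -> R).
Hypothesis Dx : forall n, ~ D (x, n).
Hypothesis kV : known X D V.
Hypothesis V0 : forall w, 0 <= V w.

Let E n := [set w | first_after (clock tau x w) (V w) n].

Let mE n : measurable (E n).
Proof.
apply: (@info_measurable _ _ _ P _ X setT); apply: known_first_after => //.
exact: sub_known kV.
Qed.

Lemma integral_first_after (F : T -> \bar R) :
  measurable_fun [set: T] F -> (forall w, 0 <= F w)%E ->
  (\int[P]_w F w = \sum_(n <oo) \int[P]_(w in E n) F w)%E.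
Proof.
move=> mF F0; have mU : measurable (\bigcup_n E n) by exact: bigcup_measurable.
have PN : P (~` \bigcup_n E n) = 0.
  apply: measure_negligible; first exact: measurableC.
  apply: negligibleS (ae_clock_good tau_exp) => w /= nE [_ ub _]; apply: nE.
  by have [n En] := first_afterP (ub x) (V w); exists n.
rewrite (ge0_negligible_integral _ _ _ _ PN)//; last exact: measurableC.
rewrite setTD setCK ge0_integral_bigcup//; first exact: measurable_funTS.
by move=> m n _ _ [w [Em En]]; exact: first_after_inj Em En.
Qed.

(* [past n] is what is known at time [V] of the other clocks and of the first
   [n] waiting times of the clock of [x], when [V] lies between the rings [n]
   and [n.+1] of this clock. *)
Let past n := D `|` [set xi : int * nat | xi.1 = x /\ (xi.2 < n)%N].

(** Measurability with respect to the past of the random time [V], in a form tested separately on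
    each event [E n]. *)
Definition known_by_stop (Z : T -> R) : Prop :=
  forall n, exists2 Zn : T -> R, known X (past n) Zn &
    (forall w, 0 <= Zn w) /\
    forall w, first_after (clock tau x w) (V w) n -> Z w = Zn w.

(** Split according to the number [n] of rings up to [V]. Given the past, waiting time [n] is only
    known to exceed the time elapsed since the last ring, so its remainder is a fresh exponential
    variable. *)
Lemma memoryless (Z : T -> R) (g : R) : g < 1 ->
  measurable_fun [set: T] Z -> (forall w, 0 <= Z w) -> known_by_stop Z ->
  (\int[P]_w (Z w * expR (g * (next_ring (clock tau x w) (V w) - V w)))%:E =
   (1 - g)^-1%:E * \int[P]_w (Z w)%:E)%E.
Proof.
move=> g1 mZ Z0 kZ.
have mV := known_measurable kV.
have mnext : measurable_fun [set: T] (fun w => next_ring (clock tau x w) (V w)).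
  have kV' : known X setT V by exact: sub_known kV.
  exact: known_measurable (known_next_ring _ kV').
rewrite integral_first_after; last 2 first.
- apply/measurable_EFinP/measurable_funM => //; apply: measurableT_comp => //.
  by apply: measurable_funM => //; exact: measurable_funB.
- by move=> w; rewrite lee_fin mulr_ge0// expR_ge0.
rewrite integral_first_after; last 2 first.
- exact/measurable_EFinP.
- by move=> w; rewrite lee_fin.
rewrite -nneseriesZl; last first.
  by move=> n _; apply: integral_ge0 => w _; rewrite lee_fin.
apply: eq_eseriesr => n _.
have [Zn kZn [Zn0 ZnE]] := kZ n.
pose K := [set w | forall i, (i < n)%N -> arrival (clock tau x w) i.+1 <= V w].
have kVn : known X (past n) V by apply: sub_known kV; exact: subsetUl.
have kK : measurable (K : set (info X (past n))).
  by apply: known_all_before => // i ni; right.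
(* The time elapsed since ring [n]. It is truncated because [stop_indep] needs [W >= 0] everywhere;
   on [K] the truncation has no effect, and [E n] is [K] together with [W < tau x n]. *)
pose W w := Num.max 0 (V w - arrival (clock tau x w) n).
have kW : known X (past n) W.
  apply: measurable_maxr; first exact: measurable_cst.
  by apply: measurable_funB => //; apply: known_arrival => i ni; right.
have W0 w : 0 <= W w by rewrite le_max lexx.
pose Z' w := Zn w * \1_K w.
have kZ' : known X (past n) Z'.
  by apply: measurable_funM => //; exact: measurable_indic kK.
have Z'0 w : 0 <= Z' w by rewrite mulr_ge0.
have npast : ~ past n (x, n) by case=> [/Dx//|[_] /=]; rewrite ltnn.
have arrival_le m w :
    (forall i, (i < m)%N -> arrival (clock tau x w) i.+1 <= V w) ->
    arrival (clock tau x w) m <= V w.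
  by case: m => [_|m]; [rewrite /arrival big_ord0|exact].
have WE w : K w -> W w = V w - arrival (clock tau x w) n.
  by move=> Kw; rewrite /W max_r// subr_ge0 arrival_le.
have restr (F : T -> R) (G : T -> R) :
    (forall w, E n w -> F w = Zn w * G w) ->
    (\int[P]_(w in E n) (F w)%:E =
     \int[P]_w (Z' w * (G w * (W w < tau x n w)%R%:R))%:E)%E.
  move=> FG; rewrite integral_mkcond; apply: eq_integral => w _; rewrite patchE.
  have EK : E n w <-> K w /\ W w < tau x n w.
    split=> [[Kw nV]|[Kw]]; last rewrite (WE _ Kw) => nV.
      split => //; rewrite (WE _ Kw) ltrBlDl.
      by move: nV; rewrite /arrival big_ord_recr.
    split => //; move: nV; rewrite ltrBlDl.
    by rewrite /arrival big_ord_recr.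
  case: ifPn => [|/negP]; rewrite inE => Ew.
    have [Kw Ww] := EK.1 Ew.
    by rewrite FG// /Z' indicE (mem_set Kw) Ww !mulr1.
  rewrite /Z' indicE; have [Kw|Kw] := pselect (K w); last first.
    by rewrite memNset// mulr0 mul0r.
  case: (ltP (W w)) => [Ww|_]; last by rewrite !mulr0.
  by case: Ew; apply/EK.
rewrite (restr (fun w => Z w * _) (fun w => expR (g * (tau x n w - W w)))).
  rewrite (stop_indep tau_exp npast kW kZ' W0 Z'0 g1).
  rewrite (restr Z (fun=> 1)); last by move=> w /ZnE ->; rewrite mulr1.
  by congr (_ * _)%E; apply: eq_integral => w _; rewrite mul1r.
move=> w Ew; rewrite (ZnE _ Ew) (next_ringE Ew) (WE _ Ew.1).
congr (_ * expR (_ * _)); rewrite /arrival big_ord_recr/=.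
by rewrite /clock; ring.
Qed.

Lemma known_by_stopW (Z : T -> R) : (forall w, 0 <= Z w) -> known X D Z ->
  known_by_stop Z.
Proof.
by move=> Z0 kZ n; exists Z => //; apply: sub_known kZ; exact: subsetUl.
Qed.

End memoryless.

(** * The Laplace transform of the meeting time *)

Section meeting.
Context d (T : measurableType d) (R : realType) (P : probability T R).
Variable tau : int -> nat -> {RV P >-> R}.
Hypothesis tau_exp : exponential_clocks tau.

Let X (xn : int * nat) : {RV P >-> R} := tau xn.1 xn.2.

Definition clocks (w : T) : int -> nat -> R := fun x n => tau x n w.

Let left_of (x : int) : set (int * nat) := [set yi | yi.1 < x].

Let left_of_le (x y : int) : x <= y -> left_of x `<=` left_of y.
Proof. by move=> xy yi /= /lt_le_trans; exact. Qed.

Let left_of_not (x : int) n : ~ left_of x (x, n).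
Proof. by rewrite /left_of /= ltxx. Qed.

Lemma known_walk (a : int) (n : nat) :
  known X (left_of (a + n%:Z)) (fun w => walk (clocks w) a n).
Proof.
elim: n => [|n IH]; first exact: measurable_cst.
apply: (@known_next_ring _ _ _ _ tau _ (a + n%:Z)).
  by move=> m; rewrite /left_of /=; lia.
by apply: sub_known IH; apply: left_of_le; lia.
Qed.

Lemma measurable_walk (a : int) (n : nat) :
  measurable_fun [set: T] (fun w => walk (clocks w) a n).
Proof. by have /known_measurable := @known_walk a n. Qed.

(** Each step is a fresh exponential wait. The case [g = al] gives the initial value of the
    martingale, the case [g = - lam] bounds its mean before the meeting. *)
Lemma integral_expR_walk (a : int) (n : nat) (g : R) : g < 1 ->
  (\int[P]_w (expR (g * walk (clocks w) a n))%:E = ((1 - g)^-1 ^+ n)%:E)%E.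
Proof.
move=> g1; elim: n => [|n IH].
  under eq_integral do rewrite /= mulr0 expR0.
  by rewrite integral_cst//= mul1e probability_setT.
rewrite exprS EFinM -IH.
have k0 := @known_walk a n.
have kZ : known X (left_of (a + n%:Z)) (fun w => expR (g * walk (clocks w) a n)).
  by apply: measurableT_comp => //; exact: measurable_funM.
have V0 w : 0 <= walk (clocks w) a n by exact: walk_ge0.
have Z0 w : 0 <= expR (g * walk (clocks w) a n) by exact: expR_ge0.
rewrite -(memoryless tau_exp (@left_of_not _) k0 V0 g1 (known_measurable kZ) Z0
  (known_by_stopW _ _ Z0 kZ)).
by apply: eq_integral => w _; rewrite -expRD; congr (expR _)%:E => /=; ring.
Qed.

Variable k : nat.
Let S x w := lead (clocks w) x.
Let U x w := chase (clocks w) k x.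

Let kS x : known X (left_of x%:Z) (S x).
Proof. by have := @known_walk 0 x; rewrite add0r. Qed.

Let kU x : known X (left_of x%:Z) (U x).
Proof.
have := @known_walk (- k%:Z) (k + x)%N.
by rewrite (_ : - k%:Z + (k + x)%N%:Z = x%:Z)//; lia.
Qed.

Let mS x : measurable_fun [set: T] (S x) := known_measurable (@kS x).
Let mU x : measurable_fun [set: T] (U x) := known_measurable (@kU x).
Let S0 x w : 0 <= S x w. Proof. exact: walk_ge0. Qed.
Let U0 x w : 0 <= U x w. Proof. exact: walk_ge0. Qed.

Let a x w : R := \1_[set w | apart (clocks w) k x] w.
Let b x w : R := \1_[set w | meet (clocks w) k x] w.

Let a0 w : a 0 w = 1.
Proof. by rewrite /a indicE mem_set. Qed.

Let aS x w : a x.+1 w = a x w * (S x.+1 w <= U x w)%R%:R.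
Proof.
rewrite /a !indicE -natrM mulnb; congr ((nat_of_bool _)%:R); apply/idP/idP.
  rewrite inE => /= ax; apply/andP; split; last exact: ax.
  by rewrite inE => /= y yx; apply: ax; exact: ltnW.
move=> /andP[]; rewrite !inE => /= ax xx y; rewrite ltnS leq_eqVlt.
by move=> /predU1P[->//|]; exact: ax.
Qed.

Let bE x w : b x w = a x w * (U x w < S x.+1 w)%R%:R.
Proof.
rewrite /a /b !indicE -natrM mulnb; congr ((nat_of_bool _)%:R); apply/idP/idP.
  by rewrite inE => -[ax xx]; rewrite xx andbT inE.
by move=> /andP[]; rewrite !inE.
Qed.

Let ab x w : a x w = a x.+1 w + b x w.
Proof.
rewrite aS bE -mulrDr ltNge; case: (S x.+1 w <= U x w);
by rewrite /= ?addr0 ?add0r mulr1.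
Qed.

Let ka x : known X (left_of x%:Z) (a x).
Proof.
elim: x => [|x IH]; first by rewrite (_ : a 0 = fun=> 1); [exact: measurable_cst|exact/funext].
rewrite (_ : a x.+1 = fun w => a x w * (S x.+1 w <= U x w)%R%:R); last exact/funext.
apply: measurable_funM; first by apply: sub_known IH; apply: left_of_le; lia.
apply: measurableT_comp => //; apply: measurable_fun_ler; first exact: kS.
by apply: sub_known (@kU x); apply: left_of_le; lia.
Qed.

Let ma x : measurable_fun [set: T] (a x) := known_measurable (@ka x).

Let mb x : measurable_fun [set: T] (b x).
Proof.
rewrite (_ : b x = fun w => a x w * (U x w < S x.+1 w)%R%:R); last exact/funext.
apply: measurable_funM => //; apply: measurableT_comp => //.
exact: measurable_fun_ltr.
Qed.

Lemma measurable_meet x : measurable [set w | meet (clocks w) k x].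
Proof. by apply/(measurable_indicP R); exact: mb. Qed.

Variables (q : R).
Hypotheses (q0 : 0 < q) (q1 : q < 1).

(* The exponential martingale [expR (al * U + be * S)] of the two walks run
   with independent clocks: [(1 - al) * (1 - be) = 1]. *)
Let al : R := 1 - q^-1.
Let be : R := 1 - q.
Let lam : R := (1 - q) ^+ 2 / q.

Let albe : al + be = - lam.
Proof. by rewrite /al /be /lam; field; rewrite gt_eqF. Qed.

Let al1 : al < 1. Proof. by rewrite gtrBl invr_gt0. Qed.
Let be1 : be < 1. Proof. by rewrite gtrBl. Qed.

Let mexp d' (T' : measurableType d') (c c' : R) (V W : T' -> R) :
  measurable_fun [set: T'] V -> measurable_fun [set: T'] W ->
  measurable_fun [set: T'] (fun w => expR (c * V w + c' * W w)).
Proof.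
move=> mV mW; apply: measurableT_comp => //.
by apply: measurable_funD; apply: measurable_funM.
Qed.

Let m x := (\int[P]_w (expR (be * S x w + al * U x w) * a x w)%:E)%E.
Let r x := (\int[P]_w (expR (- lam * U x w) * b x w)%:E)%E.

Let m_ge0 x : (0 <= m x)%E.
Proof. by apply: integral_ge0 => w _; rewrite lee_fin mulr_ge0// expR_ge0. Qed.

Let r_ge0 x : (0 <= r x)%E.
Proof. by apply: integral_ge0 => w _; rewrite lee_fin mulr_ge0// expR_ge0. Qed.

(** Optional stopping over one site. Letting the leader leave [x] multiplies by [q^-1], the moment
    for [be] ([e1]). If the walks stay apart, the departure of the other one multiplies by [q], the
    moment for [al], which compensates ([e2]). If they meet at [x], the leader's remaining wait
    after [U x] accounts for the same factor [q^-1], and [al + be = - lam] is left on [U x]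
    ([e3]). *)
Let meet_step x : (m x = m x.+1 + r x)%E.
Proof.
have e0 (c c' : R) w (c'' : R) : 0 <= c'' -> 0 <= expR (c * S x w + c' * U x w) * c''.
  by move=> ?; rewrite mulr_ge0// expR_ge0.
have SS w : S x.+1 w = next_ring (clock tau x w) (S x w) by exact: leadS.
have US w : U x.+1 w = next_ring (clock tau x w) (U x w) by exact: chaseS.
have SU w : S x w <= U x w by exact: lead_chase.
have e1 : (\int[P]_w (expR (be * S x.+1 w + al * U x w) * a x w)%:E =
    q^-1%:E * m x)%E.
  have Z0 w : 0 <= expR (be * S x w + al * U x w) * a x w by exact: e0.
  have kZ : known X (left_of x%:Z) (fun w => expR (be * S x w + al * U x w) * a x w).
    by apply: measurable_funM (@ka x); apply: mexp (@kS x) (@kU x).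
  rewrite (_ : q^-1 = (1 - be)^-1); last by rewrite /be subKr.
  rewrite -(memoryless tau_exp (@left_of_not x%:Z) (@kS x) (S0 x) be1
    (known_measurable kZ) Z0 (known_by_stopW _ _ Z0 kZ)).
  by apply: eq_integral => w _; rewrite mulrAC -expRD SS; congr (expR _ * _)%:E; ring.
have e2 : (m x.+1 =
    q%:E * \int[P]_w (expR (be * S x.+1 w + al * U x w) * a x.+1 w)%:E)%E.
  have Z0 w : 0 <= expR (be * S x.+1 w + al * U x w) * a x.+1 w.
    by rewrite mulr_ge0// expR_ge0.
  have mZ : measurable_fun [set: T]
      (fun w => expR (be * S x.+1 w + al * U x w) * a x.+1 w).
    by apply: measurable_funM => //; exact: mexp.
  have kZ : known_by_stop (P := P) tau (left_of x%:Z) x (U x)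
      (fun w => expR (be * S x.+1 w + al * U x w) * a x.+1 w).
    move=> n; set D := _ `|` _.
    have kSD : known X D (S x) by apply: sub_known (@kS x); exact: subsetUl.
    have kUD : known X D (U x) by apply: sub_known (@kU x); exact: subsetUl.
    have kaD : known X D (a x) by apply: sub_known (@ka x); exact: subsetUl.
    have kn : known X D (fun w => next_ringn (clock tau x w) n (S x w)).
      by apply: (@known_next_ringn _ _ _ _ tau) => // i ni; right.
    (* If [S x.+1 <= U x], then [S x.+1] is one of the first [n] rings, hence known at time [U x];
       in the other case the indicator vanishes. *)
    exists (fun w => expR (be * next_ringn (clock tau x w) n (S x w) + al * U x w)
      * (a x w * (S x w < next_ringn (clock tau x w) n (S x w))%R%:R)).
      apply: measurable_funM; first exact: mexp kn kUD.
      apply: measurable_funM kaD _; apply: measurableT_comp => //.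
      exact: measurable_fun_ltr kSD kn.
    split=> [w|w wn]; first by rewrite !mulr_ge0// expR_ge0.
    have [h1 [h2 _]] := next_ringn_before (SU w) wn.
    rewrite aS SS h1.
    have [Sn|nS] := ltP (S x w) (next_ringn (clock tau x w) n (S x w)).
      by rewrite (h2 Sn).
    by rewrite !mulr0.
  rewrite (_ : q = (1 - al)^-1); last by rewrite /al subKr invrK.
  rewrite -(memoryless tau_exp (@left_of_not x%:Z) (@kU x) (U0 x) al1 mZ Z0 kZ).
  by apply: eq_integral => w _; rewrite mulrAC -expRD US; congr (expR _ * _)%:E; ring.
have e3 : (\int[P]_w (expR (be * S x.+1 w + al * U x w) * b x w)%:E =
    q^-1%:E * r x)%E.
  have Z0 w : 0 <= expR (- lam * U x w) * b x w by rewrite mulr_ge0// expR_ge0.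
  have mZ : measurable_fun [set: T] (fun w => expR (- lam * U x w) * b x w).
    apply: measurable_funM => //; apply: measurableT_comp => //.
    exact: measurable_funM.
  have kZ : known_by_stop (P := P) tau (left_of x%:Z) x (U x)
      (fun w => expR (- lam * U x w) * b x w).
    move=> n; set D := _ `|` _.
    have kSD : known X D (S x) by apply: sub_known (@kS x); exact: subsetUl.
    have kUD : known X D (U x) by apply: sub_known (@kU x); exact: subsetUl.
    have kaD : known X D (a x) by apply: sub_known (@ka x); exact: subsetUl.
    have kn : known X D (fun w => next_ringn (clock tau x w) n (S x w)).
      by apply: (@known_next_ringn _ _ _ _ tau) => // i ni; right.
    exists (fun w => expR (- lam * U x w)
      * (a x w * (next_ringn (clock tau x w) n (S x w) <= S x w)%R%:R)).
      apply: measurable_funM.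
        by apply: measurableT_comp => //; apply: measurable_funM kUD.
      apply: measurable_funM kaD _; apply: measurableT_comp => //.
      exact: measurable_fun_ler kn kSD.
    split=> [w|w wn]; first by rewrite !mulr_ge0// expR_ge0.
    have [h1 _] := next_ringn_before (SU w) wn.
    by rewrite bE SS ltNge h1 -leNgt.
  rewrite (_ : q^-1 = (1 - be)^-1); last by rewrite /be subKr.
  rewrite -(memoryless tau_exp (@left_of_not x%:Z) (@kU x) (U0 x) be1 mZ Z0 kZ).
  apply: eq_integral => w _; rewrite -albe mulrAC -expRD.
  have [wm|wm] := pselect (meet (clocks w) k x); last first.
    by rewrite /b indicE memNset// !mulr0.
  have -> : S x.+1 w = next_ring (clock tau x w) (U x w).
    by rewrite -US; apply/esym; exact: meet_same.
  by congr (expR _ * _)%:E; ring.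
have : (q^-1%:E * m x = q^-1%:E * (m x.+1 + r x))%E.
  rewrite -e1 (ge0_muleDr _ (m_ge0 _) (r_ge0 _)).
  rewrite -e3 e2 muleA -EFinM mulVf ?gt_eqF// mul1e -ge0_integralD//.
  - by apply: eq_integral => w _; rewrite -EFinD -mulrDr -ab.
  - by move=> w _; rewrite lee_fin mulr_ge0// expR_ge0.
  - by apply/measurable_EFinP/measurable_funM => //; exact: mexp.
  - by move=> w _; rewrite lee_fin mulr_ge0// expR_ge0.
  - by apply/measurable_EFinP/measurable_funM => //; exact: mexp.
move=> /(congr1 (fun e => q%:E * e)%E).
by rewrite !muleA -EFinM mulfV ?gt_eqF// !mul1e.
Qed.

Let m0 : m 0 = (q ^+ k)%:E.
Proof.
rewrite /m -(invrK q) -{1}(subKr 1 q^-1) -/al.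
have := integral_expR_walk (- k%:Z) k al1; rewrite [in RHS]/al => <-.
apply: eq_integral => w _; rewrite a0 mulr1; congr (expR _)%:E.
by rewrite /S /lead /= mulr0 add0r /U /chase addn0.
Qed.

(** Since [al <= 0] and [S <= U], the exponent is at most [(al + be) * S = - lam * S], and [S x] is
    a sum of [x] independent waits. *)
Let m_le x : (m x <= (((1 + lam)^-1) ^+ x)%:E)%E.
Proof.
have lam0 : 0 < lam by rewrite divr_gt0// exprn_gt0// subr_gt0.
have lam1 : - lam < 1 by rewrite (lt_trans _ (@ltr01 R))// oppr_lt0.
have := integral_expR_walk 0 x lam1; rewrite opprK => <-.
apply: ge0_le_integral => //.
- by move=> w _; rewrite lee_fin mulr_ge0// expR_ge0.
- by apply/measurable_EFinP/measurable_funM => //; exact: mexp.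
- apply/measurable_EFinP; apply: measurableT_comp => //.
  by apply: measurable_funM => //; exact: mS.
move=> w _; rewrite lee_fin.
apply: (@le_trans _ _ (expR (be * S x w + al * U x w))).
  by rewrite ler_piMr ?expR_ge0// /a indicE; case: (_ \in _).
have SU : S x w <= U x w by exact: lead_chase.
have al0 : al <= 0 by rewrite subr_le0 invf_ge1// ltW.
have alSU : al * U x w <= al * S x w by rewrite ler_wnM2l.
rewrite ler_expR -albe -[walk _ _ _]/(S x w) [(al + be) * _]mulrDl.
by rewrite addrC lerD2r.
Qed.

(** The relation [meet_step] telescopes from [m 0], and [m x] tends to 0. *)
Lemma laplace_meet : (\sum_(x <oo) \int[P]_(w in [set w | meet (clocks w) k x])
  (expR (- ((1 - q) ^+ 2 / q) * chase (clocks w) k x))%:E = (q ^+ k)%:E)%E.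
Proof.
have lam0 : 0 < lam by rewrite divr_gt0// exprn_gt0// subr_gt0.
transitivity (\sum_(x <oo) r x)%E.
  apply: eq_eseriesr => x _; rewrite integral_mkcond.
  apply: eq_integral => w _; rewrite patchE /b indicE.
  by case: ifP; rewrite ?mulr1 ?mulr0.
have mfin x : m x \is a fin_num.
  by rewrite ge0_fin_numE// (le_lt_trans (m_le x))// ltry.
have part n : (\sum_(0 <= x < n) r x = (q ^+ k)%:E - m n)%E.
  elim: n => [|n IH]; first by rewrite big_nil -m0 subee.
  rewrite big_nat_recr//= IH; have := meet_step n.
  have rfin : r n \is a fin_num.
    have := mfin n; rewrite meet_step fin_numD => /andP[_]; exact.
  move=> ->; rewrite fin_num_oppeD// -addeA; congr (_ + _)%E.
  by rewrite subeK.
have cm : (m x @[x --> \oo] --> 0)%E.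
  apply: (@squeeze_cvge _ _ _ _ (fun=> 0%E) _ (fun x => (((1 + lam)^-1) ^+ x)%:E)).
  - by apply: nearW => x; rewrite m_ge0 m_le.
  - exact: cvg_cst.
  - apply: cvg_EFin; first exact: nearW.
    apply: cvg_expr; rewrite ger0_norm ?invr_ge0 ?addr_ge0 ?ltW//.
    by rewrite invf_lt1 ?addr_gt0// ltrDl.
apply: cvg_lim => //; under eq_fun do rewrite part.
rewrite -[X in nbhs X]sube0; apply: cvgeB => //; exact: cvg_cst.
Qed.

End meeting.

(** * The Laplace transform of the limit law *)

Lemma measurable_invr (R : realType) : measurable_fun [set: R] (fun x : R => x^-1).
Proof.
rewrite -(setUv [set 0 : R]); apply/measurable_funU => //.
  exact: measurableC.
split; first exact: measurable_fun_set1.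
apply: open_continuous_measurable_fun.
  by apply: closed_openC; exact: closed_eq.
by move=> x; rewrite inE /= => /eqP x0; exact: inv_continuous.
Qed.

Section limit_law.
Variable R : realType.
Notation mu := (@lebesgue_measure R).

Let phi : R -> R := normal_pdf 0 (Num.sqrt 2).
Let Phi (w : R) : R := (\int[mu]_(x in `]-oo, w]) phi x)%R.

Let phi_ge0 x : 0 <= phi x. Proof. exact: normal_pdf_ge0. Qed.

Let phi_cont : continuous phi. Proof. exact: continuous_normal_pdf. Qed.

Let phi_int : mu.-integrable [set: R] (EFin \o phi).
Proof. exact: integrable_normal_pdf. Qed.

Let phiE x : phi x = (2 * Num.sqrt pi)^-1 * expR (- (x ^+ 2 / 4)).
Proof.
rewrite /phi normal_pdfE// /normal_peak /normal_fun subr0 sqr_sqrtr//.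
have -> : 2 * pi *+ 2 = 2 ^+ 2 * pi :> R by rewrite -mulr_natr; ring.
rewrite sqrtrM ?sqr_ge0// sqrtr_sqr ger0_norm//.
by rewrite mulNr -(mulr_natr 2 2) -natrM.
Qed.

Let dPhi (w : R) : is_derive w 1 Phi (phi w).
Proof.
have [] := @continuous_FTC1 R phi -oo%O w (w + 1) _ _ _ (@phi_cont w).
- by rewrite ltrDl.
- exact: integrableS phi_int.
- exact: ltNyr.
by move=> ? <-; rewrite derive1E; exact: DeriveDef.
Qed.

(** The identity as a random variable under [N2]: [Phi] is then a cumulative distribution function,
    whose limits at both ends are known. *)
Let idTR : measurableTypeR R -> R := idfun.

#[local] HB.instance Definition _ :=
  @isMeasurableFun.Build _ _ _ _ idTR (@measurable_id _ _ setT).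

Let N2 : probability (measurableTypeR R) R := normal_prob 0 (Num.sqrt 2).

Let cvg_PhiNy : Phi x @[x --> -oo] --> (0 : R).
Proof. by apply: fine_cvg; exact: (cvg_cdfNy0 (idTR : {RV N2 >-> R})). Qed.

Let cvg_Phiy : Phi x @[x --> +oo] --> (1 : R).
Proof. by apply: fine_cvg; exact: (cvg_cdfy1 (idTR : {RV N2 >-> R})). Qed.

Let F (c z : R) : R :=
  expR (- c) * Phi (z - 2 * c / z) + expR c * Phi (z + 2 * c / z).
Let f (c z : R) : R := 2 * phi z * expR (- (c / z) ^+ 2).

(** Completing the square, [(z - 2 * c / z) ^+ 2 / 4 = z ^+ 2 / 4 + (c / z) ^+ 2 - c], and likewise
    with [- c] for [c]. The prefactors of [F] thus cancel against [expR c] and [expR (- c)], and the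
    terms in [2 * c / z ^+ 2] cancel each other. *)
Let dF (c z : R) : 0 < z -> is_derive z 1 (F c) (f c z).
Proof.
move=> z0; have zn0 : z != 0 by rewrite gt_eqF.
have dinv : is_derive z 1 (fun z : R => z^-1) (- z ^- 2).
  apply: DeriveDef; first exact: (@derivableV _ _ id).
  by rewrite (@deriveV _ _ id)// derive_id -[_ *: _]/(_ * _) mulr1.
have d1 : is_derive z 1 (fun z => z - 2 * c / z) (1 + 2 * c / z ^+ 2).
  by apply: is_derive_eq; rewrite -?[_ *: _]/(_ * _); field.
have d2 : is_derive z 1 (fun z => z + 2 * c / z) (1 - 2 * c / z ^+ 2).
  by apply: is_derive_eq; rewrite -?[_ *: _]/(_ * _); field.
have D1 := @is_derive1_comp _ Phi (fun z => z - 2 * c / z) z _ _ (dPhi _) d1.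
have D2 := @is_derive1_comp _ Phi (fun z => z + 2 * c / z) z _ _ (dPhi _) d2.
have p1 : phi (z - 2 * c / z) = phi z * (expR c * expR (- (c / z) ^+ 2)).
  by rewrite !phiE -!mulrA -!expRD; congr (_ * expR _); field.
have p2 : phi (z + 2 * c / z) = phi z * (expR (- c) * expR (- (c / z) ^+ 2)).
  by rewrite !phiE -!mulrA -!expRD; congr (_ * expR _); field.
have ec : expR c * expR (- c) = 1 by rewrite -expRD subrr expR0.
have dFz : is_derive z 1 (F c) (expR (- c) * (phi (z - 2 * c / z) * (1 + 2 * c / z ^+ 2))
   + expR c * (phi (z + 2 * c / z) * (1 - 2 * c / z ^+ 2))).
  exact: is_deriveD.
apply: (is_derive_eq dFz); rewrite p1 p2 /f.
transitivity ((expR c * expR (- c)) * (2 * phi z * expR (- (c / z) ^+ 2))).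
  by set k := 2 * c / z ^+ 2; ring.
by rewrite ec mul1r.
Qed.

Let f_cont (c z : R) : 0 < z -> {for z, continuous (f c)}.
Proof.
move=> z0; rewrite /f; apply: cvgM.
  by apply: cvgM; [exact: cvg_cst|exact: phi_cont].
apply: continuous_comp; last exact: continuous_expR.
apply: cvgN; apply: (cvg_comp (fun z => c / z) (fun x => x ^+ 2)).
  by apply: cvgM; [exact: cvg_cst|apply: cvgV; [rewrite gt_eqF|exact: cvg_id]].
exact: sqr_continuous.
Qed.

Let cvg_Fy (c : R) : 0 < c -> F c z @[z --> +oo] --> expR (- c) + expR c.
Proof.
move=> c0.
have -> : expR (- c) + expR c = expR (- c) * 1 + expR c * 1 by rewrite !mulr1.
have large (A : R) : \forall z \near +oo, 0 < 2 * c / z /\ A <= z - 2 * c / z.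
  near=> z.
  have z1 : 1 <= z by near: z; exact: nbhs_pinfty_ge.
  have zA : A + 2 * c <= z by near: z; apply: nbhs_pinfty_ge; exact: num_real.
  have z0 : 0 < z by exact: lt_le_trans z1.
  have c20 : 0 <= 2 * c by rewrite mulr_ge0// ltW.
  have : 2 * c / z <= 2 * c by rewrite ler_piMr// invf_le1.
  by split; [rewrite !divr_gt0// mulr_gt0|lra].
apply: cvgD; apply: cvgM; try exact: cvg_cst.
- apply: (cvg_comp (fun z => z - 2 * c / z) Phi _ cvg_Phiy).
  by apply/cvgryPge => A; have := large A; apply: filterS => z [].
- apply: (cvg_comp (fun z => z + 2 * c / z) Phi _ cvg_Phiy).
  by apply/cvgryPge => A; have := large A; apply: filterS => z []; lra.
Unshelve. all: by end_near. Qed.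

Let cvg_F0 (c : R) : 0 < c -> F c z @[z --> 0^'+] --> expR c.
Proof.
move=> c0.
have -> : expR c = expR (- c) * 0 + expR c * 1 by rewrite mulr0 add0r mulr1.
have small (A : R) : \forall z \near 0^'+,
    [/\ 0 < z, z < 1 & `|A| + 1 <= 2 * c / z].
  near=> z.
  have z0 : 0 < z by near: z; exact: nbhs_right_gt.
  have z1 : z < 1 by near: z; apply: nbhs_right_lt; exact: ltr01.
  split => //.
  have A0 : 0 < `|A| + 1 by rewrite ltr_wpDl.
  rewrite ler_pdivlMr// mulrC -ler_pdivlMr//.
  by near: z; apply: nbhs_right_le; rewrite divr_gt0// mulr_gt0.
apply: cvgD; apply: cvgM; try exact: cvg_cst.
- apply: (cvg_comp (fun z => z - 2 * c / z) Phi _ cvg_PhiNy).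
  apply/cvgrNyPle => A; have := small A; apply: filterS => z [z0 z1 zA].
  have := lerNnormlW (lexx `|A|); lra.
- apply: (cvg_comp (fun z => z + 2 * c / z) Phi _ cvg_Phiy).
  apply/cvgryPge => A; have := small A; apply: filterS => z [z0 z1 zA].
  have := ler_norm A; lra.
Unshelve. all: by end_near. Qed.

Let limit_pdf_gt0 (z : R) : 0 < z -> limit_pdf z = 2 * phi z.
Proof. by move=> z0; rewrite limit_pdfE indicE mem_set ?mulr1//= in_itv/= ltW. Qed.

Lemma limit_pdf_le1 (z : R) : limit_pdf z <= 1.
Proof.
have pi1 : 1 <= Num.sqrt pi :> R.
  by rewrite -sqrtr1 ler_wsqrtr// (le_trans _ (@pi_ge2 R))// ler1n.
have pi0 : 0 < Num.sqrt pi :> R by rewrite (lt_le_trans ltr01).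
have e1 : expR (- (z ^+ 2 / 4)) <= 1.
  by rewrite -expR0 ler_expR oppr_le0 divr_ge0// sqr_ge0.
have ind1 : (\1_`[0, +oo[ z : R) <= 1 by rewrite indicE; case: (_ \in _).
have s0 : 0 <= (Num.sqrt pi)^-1 :> R by rewrite invr_ge0 ltW.
have s1 : (Num.sqrt pi)^-1 <= 1 :> R by rewrite invf_le1.
have e0 := expR_ge0 (- (z ^+ 2 / 4)).
by rewrite /limit_pdf mulr_ile1// ?mulr_ge0// mulr_ile1.
Qed.

Let limit_pdf_integrable : mu.-integrable [set: R] (EFin \o @limit_pdf R).
Proof.
apply/integrableP; split; first (apply/measurable_EFinP; exact: measurable_limit_pdf).
under eq_integral do rewrite /= ger0_norm ?limit_pdf_ge0//.
by rewrite integral_limit_pdf ltry.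
Qed.

(** On the positive half line [F c] increases from [expR c] to [expR (- c) + expR c]. *)
Lemma laplace_limit_prob (c : R) : 0 < c ->
  (\int[limit_prob (R := R)]_z (expR (- (c / z) ^+ 2))%:E = (expR (- c))%:E)%E.
Proof.
move=> c0.
have mf : measurable_fun [set: R] (fun z : R => expR (- (c / z) ^+ 2)).
  apply: measurableT_comp => //; apply: measurableT_comp => //.
  apply: measurable_funX; apply: measurable_funM => //.
  exact: measurable_invr.
have me0 (z : R) : (0 <= (expR (- (c / z) ^+ 2))%:E)%E by rewrite lee_fin expR_ge0.
rewrite (@ge0_integral_density _ _ _ mu _ _ _ (@limit_pdf_ge0 R)
  limit_pdf_integrable _ me0)//; last exact/measurable_EFinP.
pose E n := `[n.+1%:R^-1 : R, +oo[%classic.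
have n0 n : 0 < n.+1%:R^-1 :> R by rewrite invr_gt0.
have EE : `]0, +oo[%classic = \bigcup_n E n.
  by rewrite itvoyEbigcup; under eq_bigcupr do rewrite add0r.
(* The convention [c / 0 = 0] makes [f c] discontinuous at 0, so the fundamental theorem is applied
   on the intervals [E n], which stay away from 0. *)
have mfc : measurable_fun (`]0, +oo[%classic : set R) (f c).
  apply: open_continuous_measurable_fun; first exact: interval_open.
  by move=> x; rewrite inE/= in_itv/= andbT => x0; exact: f_cont.
transitivity (\int[mu]_(z in \bigcup_n E n) (f c z)%:E)%E.
  rewrite -EE.
  transitivity (\int[mu]_(z in `[0%R, +oo[)
      ((expR (- (c / z) ^+ 2))%:E * (limit_pdf z)%:E))%E.
    rewrite [RHS]integral_mkcond; apply: eq_integral => z _; rewrite patchE.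
    case: ifPn => //; rewrite notin_setE /= in_itv/= andbT => z0.
    by rewrite /limit_pdf indicE memNset ?mulr0 ?mule0//= in_itv/= andbT.
  rewrite -integral_itv_obnd_cbnd; last first.
    apply: measurable_funTS; apply: emeasurable_funM.
      exact/measurable_EFinP.
    by apply/measurable_EFinP; exact: measurable_limit_pdf.
  apply: eq_integral => z; rewrite inE/= in_itv/= andbT => z0.
  by rewrite limit_pdf_gt0// -EFinM mulrC.
have cvE : (\int[mu]_(z in E n) (f c z)%:E @[n --> \oo] -->
    \int[mu]_(z in \bigcup_n E n) (f c z)%:E)%E.
  apply: ge0_nondecreasing_set_cvg_integral => //.
  - move=> m n mn; apply/subsetPset; apply: subset_itvr.
    by rewrite bnd_simp lef_pV2 ?posrE// ler_nat.
  - by move=> n; exact: measurable_itv.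
  - move=> n; apply/measurable_EFinP; apply: measurable_funS mfc => //.
    by rewrite EE => z nz; exists n.
  - by move=> n z _; rewrite lee_fin mulr_ge0 ?expR_ge0// mulr_ge0.
rewrite -(cvg_lim _ cvE)//; apply: cvg_lim => //.
have EF n : (\int[mu]_(z in E n) (f c z)%:E =
    (expR (- c) + expR c - F c n.+1%:R^-1)%:E)%E.
  rewrite (@ge0_continuous_FTC2y _ (f c) (F c) _ (expR (- c) + expR c)) ?EFinB//.
  - by move=> z _; rewrite mulr_ge0 ?expR_ge0// mulr_ge0.
  - apply: continuous_in_subspaceT => z; rewrite inE/= in_itv/= andbT => nz.
    by apply: f_cont; exact: lt_le_trans nz.
  - exact: cvg_Fy.
  - by move=> z nz; case: (dF c (lt_trans (n0 n) nz)).
  - apply: cvg_at_right_filter; apply: differentiable_continuous.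
    by apply/derivable1_diffP; case: (dF c (n0 n)).
  - move=> z; rewrite in_itv/= andbT => nz.
    by rewrite derive1E; case: (dF c (lt_trans (n0 n) nz)).
have cn : n.+1%:R^-1 @[n --> \oo] --> (0 : R)^'+.
  move=> A [e /= e0 He]; have := near_infty_natSinv_lt (PosNum e0).
  apply: filterS => n /= ne; apply: He => //=.
  by rewrite sub0r normrN ger0_norm// ltW.
have cF : (expR (- c) + expR c - F c n.+1%:R^-1) @[n --> \oo] -->
    expR (- c) + expR c - expR c.
  apply: cvgB; first exact: cvg_cst.
  exact: (cvg_comp (fun n : nat => n.+1%:R^-1 : R) (F c) cn (cvg_F0 c0)).
rewrite addrK in cF; under eq_fun do rewrite EF.
by apply: cvg_EFin; [exact: nearW|exact: cF].
Qed.

(** The density is at most 1, so the limiting distribution function is 1-Lipschitz; this turns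
    errors in position into errors in probability. *)
Lemma limit_prob_itv (a b : R) : a <= b ->
  (limit_prob (R := R) `]a, b] <= (b - a)%:E)%E.
Proof.
move=> ab; apply: (@le_trans _ _ (\int[mu]_(z in `]a, b]) 1)%E).
  apply: ge0_le_integral => //.
  - by move=> z _; rewrite lee_fin limit_pdf_ge0.
  - by apply/measurable_EFinP/measurable_funTS; exact: measurable_limit_pdf.
  - by move=> z _; rewrite lee_fin limit_pdf_le1.
rewrite integral_cst//= mul1e lebesgue_measure_itv/= lte_fin.
by case: ltP => // _; rewrite lee_fin subr_ge0.
Qed.

Lemma limit_prob_Ny0 (x : R) : x < 0 -> limit_prob (R := R) `]-oo, x] = 0.
Proof.
move=> x0; apply: integral0_eq => z; rewrite /= in_itv/= => zx.
rewrite /limit_pdf indicE memNset ?mulr0//= in_itv/= andbT.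
by apply/negP; rewrite -ltNge (le_lt_trans zx).
Qed.

End limit_law.

(** * Convergence of moments *)

Lemma bernoulli_ineq (R : realType) (v : R) (N : nat) : 0 <= v -> v <= 1 ->
  1 - N%:R * v <= (1 - v) ^+ N /\ (1 - v) ^+ N * (1 + N%:R * v) <= 1.
Proof.
move=> v0 v1; elim: N => [|N [IH1 IH2]].
  by rewrite !expr0 !mul0r subr0 addr0 mulr1 lexx.
have N0 : 0 <= N%:R :> R by [].
have Nv0 : 0 <= N%:R * v by rewrite mulr_ge0.
have e0 : 0 <= (1 - v) ^+ N by rewrite exprn_ge0// subr_ge0.
rewrite exprSr -natr1; split.
  have : (1 - N%:R * v) * (1 - v) <= (1 - v) ^+ N * (1 - v).
    by rewrite ler_wpM2r// subr_ge0.
  apply: le_trans; have : 0 <= N%:R * v * v by rewrite mulr_ge0.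
  lra.
apply: le_trans IH2; rewrite -mulrA ler_wpM2l//.
have : 0 <= (N%:R + 1) * (v * v) by rewrite !mulr_ge0// addr_ge0.
lra.
Qed.

(* The polynomial [1 - (1 - y ^ a) ^ (2 ^ a)] is close to [0] when
   [(2 * y) ^ a] is small and close to [1] when it is large. *)
Lemma step_poly (R : realType) (y1 y2 e : R) :
  0 <= y1 -> y1 < 2^-1 -> 2^-1 < y2 -> 0 < e ->
  exists p : {poly R}, forall y, 0 <= y -> y <= 1 ->
    [/\ 0 <= p.[y], p.[y] <= 1, y <= y1 -> p.[y] <= e & y2 <= y -> 1 - e <= p.[y]].
Proof.
move=> y10 y1h y2h e0.
have y2p : 0 < y2 by rewrite (lt_trans _ y2h)// invr_gt0.
have [a [a1 a2]] : exists a : nat, (2 * y1) ^+ a <= e /\ (2 * y2) ^- a <= e.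
  have c1 : (2 * y1) ^+ n @[n --> \oo] --> (0 : R).
    by apply: cvg_expr; rewrite ger0_norm ?mulr_ge0//; lra.
  have c2 : ((2 * y2)^-1) ^+ n @[n --> \oo] --> (0 : R).
    apply: cvg_expr; rewrite ger0_norm ?invr_ge0 ?mulr_ge0 ?ltW//.
    by rewrite invf_lt1 ?mulr_gt0//; lra.
  have : \forall n \near \oo, `|(2 * y1) ^+ n| <= e /\ `|((2 * y2)^-1) ^+ n| <= e.
    by near=> n; split; near: n; apply: cvgr0_norm_le.
  move=> /filter_ex[n [h1 h2]]; exists n; split.
    by rewrite (le_trans (ler_norm _)).
  by rewrite -exprVn (le_trans (ler_norm _)).
exists (1 - (1 - 'X^a) ^+ (2 ^ a)) => y y0 yle1; rewrite !hornerE.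
have v0 : 0 <= y ^+ a by rewrite exprn_ge0.
have v1 : y ^+ a <= 1 by rewrite exprn_ile1.
(* With [v = y ^+ a] and [N = 2 ^ a], the value [1 - (1 - v) ^+ N] lies between [1 - (1 + N v)^-1]
   and [N v], where [N v = (2 * y) ^+ a]. *)
have [b1 b2] := bernoulli_ineq (2 ^ a) v0 v1.
have NE : (2 ^ a)%:R * y ^+ a = (2 * y) ^+ a by rewrite natrX exprMn.
rewrite NE in b1 b2.
have w0 : 0 <= (1 - y ^+ a) ^+ (2 ^ a) by rewrite exprn_ge0// subr_ge0.
have w1 : (1 - y ^+ a) ^+ (2 ^ a) <= 1 by rewrite exprn_ile1 ?subr_ge0// gerBl.
split.
- by rewrite subr_ge0.
- by rewrite gerBl.
- move=> yy1; have : (2 * y) ^+ a <= (2 * y1) ^+ a.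
    by rewrite lerXn2r ?nnegrE ?mulr_ge0// ler_wpM2l.
  lra.
- move=> y2y; rewrite lerD2l lerN2; apply: le_trans a2.
  have z0 : 0 < (2 * y2) ^+ a by rewrite exprn_gt0// mulr_gt0.
  have z1 : (2 * y2) ^+ a <= (2 * y) ^+ a.
    by rewrite lerXn2r ?nnegrE ?mulr_ge0 ?(ltW y2p)// ler_wpM2l.
  rewrite -[leRHS]mul1r ler_pdivlMr//; apply: le_trans b2.
  by rewrite ler_wpM2l//; lra.
Unshelve. all: by end_near. Qed.

Section unit_interval_variable.
Context d (T : measurableType d) (R : realType) (P : probability T R).
Variable Y : T -> R.
Hypotheses (mY : measurable_fun [set: T] Y).
Hypotheses (Y0 : forall w, 0 <= Y w) (Y1 : forall w, Y w <= 1).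

Let bounded_int (h : T -> R) (M : R) : measurable_fun [set: T] h ->
  (forall w, `|h w| <= M) -> P.-integrable [set: T] (EFin \o h).
Proof.
move=> mh hM; apply: measurable_bounded_integrable => //.
  by rewrite (le_lt_trans (probability_le1 _ _)) ?ltry.
exists M; split; first exact: num_real.
by move=> N MN w _ /=; rewrite (le_trans (hM w))// ltW.
Qed.

Let pow_int n : P.-integrable [set: T] (EFin \o (fun w => Y w ^+ n)).
Proof.
apply: (@bounded_int _ 1); first exact: measurable_funX.
by move=> w; rewrite ger0_norm ?exprn_ge0// exprn_ile1.
Qed.

Lemma expectation_poly (p : {poly R}) :
  \int[P]_w p.[Y w] = \sum_(i < size p) p`_i * \int[P]_w (Y w ^+ i).
Proof.
transitivity (\int[P]_w (\sum_(i < size p) p`_i * Y w ^+ i)).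
  by apply: eq_Rintegral => w _; rewrite horner_coef.
rewrite /Rintegral; under eq_integral do rewrite -sumEFin.
rewrite integral_sum//; last first.
  by move=> i; under eq_fun do rewrite EFinM; exact: integrableZl (pow_int i).
rewrite -sum_fine; last first.
  move=> i _; under eq_integral do rewrite EFinM.
  by rewrite integralZl ?fin_numM ?integrable_fin_num//; exact: pow_int.
apply: eq_bigr => i _; exact: RintegralZl (pow_int i).
Qed.

(** Pointwise, [p] differs from a step by at most [e] off the gap between [y1] and [y2]: the
    indicator of [y2 <= Y] is at most [p.[Y] + e], and [p.[Y]] is at most the indicator of [y1 <= Y]
    plus [e]. *)
Lemma expectation_step (p : {poly R}) (y1 y2 e : R) :
  (forall y, 0 <= y -> y <= 1 ->
    [/\ 0 <= p.[y], p.[y] <= 1, y <= y1 -> p.[y] <= e & y2 <= y -> 1 - e <= p.[y]]) ->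
  0 <= e ->
  fine (P [set w | y2 <= Y w]) <= \int[P]_w p.[Y w] + e /\
  \int[P]_w p.[Y w] <= fine (P [set w | y1 <= Y w]) + e.
Proof.
move=> pE e0.
have mp : measurable_fun [set: T] (fun w => p.[Y w]).
  under eq_fun do rewrite horner_coef.
  apply: measurable_sum => i; apply: measurable_funM => //.
  exact: measurable_funX.
have ip : P.-integrable [set: T] (EFin \o (fun w => p.[Y w])).
  apply: (@bounded_int _ 1) => // w.
  by have [p0 p1 _ _] := pE _ (Y0 w) (Y1 w); rewrite ger0_norm.
have mA y : measurable [set w | y <= Y w] by exact: measurable_set_ler.
have ind y : fine (P [set w | y <= Y w]) = \int[P]_w (\1_[set w | y <= Y w] w).
  by rewrite /Rintegral integral_indic// setIT.
have iind y : P.-integrable [set: T] (EFin \o \1_[set w | y <= Y w]).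
  apply: (@bounded_int _ 1) => [|w]; first exact: measurable_indic.
  by rewrite indicE; case: (_ \in _); rewrite /= ?normr1// normr0.
have ie : P.-integrable [set: T] (EFin \o (fun=> e)).
  by apply: (@bounded_int _ e) => // w; rewrite ger0_norm.
have ipe : P.-integrable [set: T] (EFin \o (fun w => p.[Y w] + e)).
  by have := integrableD measurableT ip ie.
have iye y : P.-integrable [set: T] (EFin \o (fun w => \1_[set w | y <= Y w] w + e)).
  by have := integrableD measurableT (iind y) ie.
have eE : e = \int[P]_(w in [set: T]) e.
  by rewrite Rintegral_cst// [fine _](congr1 fine (probability_setT P)) mulr1.
rewrite !ind eE -!RintegralD//; split; apply: le_Rintegral => //.
- move=> w _; rewrite indicE; have [p0 p1 pl ph] := pE _ (Y0 w) (Y1 w).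
  have [yw|yw] := leP y2 (Y w).
    by rewrite mem_set//= -lerBlDr; exact: ph.
  by rewrite memNset ?addr_ge0//=; apply/negP; rewrite -ltNge.
- move=> w _; rewrite indicE; have [p0 p1 pl ph] := pE _ (Y0 w) (Y1 w).
  have [yw|yw] := leP y1 (Y w).
    by rewrite mem_set//=; lra.
  rewrite memNset ?add0r; first by apply: pl; exact: ltW.
  by apply/negP; rewrite -ltNge.
Qed.

End unit_interval_variable.

Lemma moments_step (I : Type) (G : set_system I) (FG : Filter G)
    d (T : measurableType d) (R : realType) (P : probability T R)
    d' (T' : measurableType d') (Q : probability T' R)
    (Y : I -> T -> R) (Z : T' -> R) (y1 y2 e : R) :
  (forall i, measurable_fun [set: T] (Y i)) ->
  (forall i w, 0 <= Y i w) -> (forall i w, Y i w <= 1) ->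
  measurable_fun [set: T'] Z -> (forall w, 0 <= Z w) -> (forall w, Z w <= 1) ->
  (forall n, \int[P]_w (Y i w ^+ n.+1) @[i --> G] --> \int[Q]_z (Z z ^+ n.+1)) ->
  0 <= y1 -> y1 < 2^-1 -> 2^-1 < y2 -> 0 < e ->
  \forall i \near G,
    fine (P [set w | y2 <= Y i w]) <= fine (Q [set z | y1 <= Z z]) + e /\
    fine (Q [set z | y2 <= Z z]) <= fine (P [set w | y1 <= Y i w]) + e.
Proof.
move=> mY Y0 Y1 mZ Z0 Z1 YZ y10 y1h y2h e0.
(* One third for the polynomial under each of the two laws, and one third for the convergence of its
   mean. The moment of order 0 is 1 on both sides. *)
have e3 : 0 < e / 3 by rewrite divr_gt0.
have [p pE] := step_poly y10 y1h y2h e3.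
have pYZ : \int[P]_w p.[Y i w] @[i --> G] --> \int[Q]_z p.[Z z].
  rewrite expectation_poly//.
  rewrite (_ : (fun i => _) = fun i => \sum_(j < size p) p`_j * \int[P]_w (Y i w ^+ j)).
    elim: (size p) => [|m IH].
      by under eq_fun do rewrite big_ord0; rewrite big_ord0; exact: cvg_cst.
    under eq_fun do rewrite big_ord_recr; rewrite big_ord_recr; apply: cvgD => //.
    apply: cvgM; first exact: cvg_cst; case: m {IH} => [|n]; last exact: YZ.
    under eq_fun do under eq_Rintegral do rewrite expr0.
    under [X in nbhs X]eq_Rintegral do rewrite expr0.
    rewrite !Rintegral_cst// [fine (P _)](congr1 fine (probability_setT P)).
    rewrite [fine (Q _)](congr1 fine (probability_setT Q)); exact: cvg_cst.
  by apply/funext => i; exact: expectation_poly.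
move/cvgrPdist_le : pYZ => /(_ _ e3); apply: filterS => i; rewrite ler_distl => /andP[h1 h2].
have [a1 a2] := @expectation_step _ _ _ P _ (@mY i) (Y0 i) (Y1 i) _ _ _ _ pE (ltW e3).
have [b1 b2] := @expectation_step _ _ _ Q _ mZ Z0 Z1 _ _ _ _ pE (ltW e3).
by split; lra.
Qed.

Lemma measurable_bigcup_int d (T : measurableType d) (F : int -> set T) :
  (forall z, measurable (F z)) -> measurable (\bigcup_z F z).
Proof.
move=> mF; rewrite (_ : \bigcup_z F z =
    (\bigcup_n F (Posz n)) `|` (\bigcup_n F (Negz n))).
  by apply: measurableU; apply: bigcup_measurable.
apply/seteqP; split => [w [[n|n] _ Fw]|w [[n _ Fw]|[n _ Fw]]].
- by left; exists n.
- by right; exists n.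
- by exists (Posz n).
- by exists (Negz n).
Qed.

Lemma measurable_bigcap_int d (T : measurableType d) (F : int -> set T) (D : set int) :
  (forall z, D z -> measurable (F z)) -> measurable (\bigcap_(z in D) F z).
Proof.
move=> mF; rewrite -[X in measurable X]setCK setC_bigcap bigcup_mkcond.
apply/measurableC/measurable_bigcup_int => z.
by case: ifPn => [|_]; [rewrite inE => Dz; exact/measurableC/mF|exact: measurable0].
Qed.

(** * The law of the leader *)

Section hitting.
Context d (T : measurableType d) (R : realType) (P : probability T R).
Variable tau : int -> nat -> {RV P >-> R}.
Hypothesis tau_exp : exponential_clocks tau.
Variable k : nat.

Definition met : set T := [set w | exists x, meet (clocks tau w) k x].

(** Outside [met] the value is taken at site 0 and has no meaning as a meeting time; the transform
    and the events below are restricted to [met]. *)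
Definition meeting_time (w : T) : R :=
  chase (clocks tau w) k (xget 0%N [set x | meet (clocks tau w) k x]).

Let metE : met = \bigcup_x [set w | meet (clocks tau w) k x].
Proof. by apply/seteqP; split => w [x]; exists x. Qed.

Let meet_inj w x y : meet (clocks tau w) k x -> meet (clocks tau w) k y -> x = y.
Proof.
have lt_ x' y' : meet (clocks tau w) k x' -> meet (clocks tau w) k y' ->
    (x' < y')%N -> False.
  by move=> [_ mx] [ay _] /ay; rewrite leNgt mx.
by move=> mx my; case: (ltngtP x y) => // [/(lt_ _ _ mx my)|/(lt_ _ _ my mx)].
Qed.

Let meeting_timeE w x : meet (clocks tau w) k x ->
  meeting_time w = chase (clocks tau w) k x.
Proof.
move=> mx; rewrite /meeting_time; congr chase.
by apply: xget_unique => // y /meet_inj; apply.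
Qed.

Lemma meeting_time_le (w : T) (t : R) : met w /\ meeting_time w <= t <->
  exists x, meet (clocks tau w) k x /\ chase (clocks tau w) k x <= t.
Proof.
split=> [[[x mx]]|[x [mx xt]]]; first by rewrite (meeting_timeE mx); exists x.
by split; [exists x|rewrite (meeting_timeE mx)].
Qed.

Lemma meeting_time_ge0 (w : T) : 0 <= meeting_time w.
Proof. exact: walk_ge0. Qed.

Lemma measurable_met : measurable met.
Proof. by rewrite metE; apply: bigcup_measurable => x _; exact: measurable_meet. Qed.

Lemma measurable_meeting_time : measurable_fun met meeting_time.
Proof.
rewrite metE; apply/measurable_fun_bigcup => [x|x]; first exact: measurable_meet.
apply: (eq_measurable_fun (fun w => chase (clocks tau w) k x)).
  by move=> w; rewrite inE => /meeting_timeE.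
apply: measurable_funTS; exact: measurable_walk.
Qed.

Lemma laplace_meeting_time (q : R) : 0 < q -> q < 1 ->
  (\int[P]_(w in met) (expR (- ((1 - q) ^+ 2 / q) * meeting_time w))%:E =
   (q ^+ k)%:E)%E.
Proof.
move=> q0 q1; rewrite -(laplace_meet tau_exp k q0 q1) {1}metE.
have mF (x : nat) : measurable [set w | meet (clocks tau w) k x] by exact: measurable_meet.
have mf : measurable_fun (\bigcup_x [set w | meet (clocks tau w) k x])
    (fun w => (expR (- ((1 - q) ^+ 2 / q) * meeting_time w))%:E).
  rewrite -metE; apply/measurable_EFinP; apply: measurableT_comp => //.
  by apply: measurable_funM => //; exact: measurable_meeting_time.
rewrite (ge0_integral_bigcup P mF mf); last 2 first.
- by move=> w _; rewrite lee_fin expR_ge0.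
- by move=> x y _ _ [w [mx my]]; exact: meet_inj mx my.
apply: eq_eseriesr => x _; apply: eq_integral => w; rewrite inE => mx.
by rewrite (meeting_timeE mx).
Qed.

End hitting.

(* [(1 - q) ^+ 2 / q = 4 * s ^+ 2] for [q = decay s ^+ 2]. *)
Definition decay (R : realType) (s : R) : R := Num.sqrt (1 + s ^+ 2) - s.

(** * Asymptotics of the transform on the diffusive scale *)

Section decay.
Variables (R : realType) (s : R).
Hypothesis s0 : 0 < s.

Let sq : Num.sqrt (1 + s ^+ 2) ^+ 2 = 1 + s ^+ 2.
Proof. by rewrite sqr_sqrtr// addr_ge0// sqr_ge0. Qed.

Lemma decay_gt0 : 0 < decay s.
Proof. by rewrite subr_gt0 -(ltr_pXn2r (n := 2)) ?nnegrE ?(ltW s0)// sq ltrDr. Qed.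

Lemma decay_inv : (decay s)^-1 = Num.sqrt (1 + s ^+ 2) + s.
Proof.
apply: (mulfI (lt0r_neq0 decay_gt0)); rewrite divff ?lt0r_neq0 ?decay_gt0//.
by rewrite /decay -subr_sqr sq; ring.
Qed.

Let sq_le : Num.sqrt (1 + s ^+ 2) <= 1 + s ^+ 2 / 2.
Proof.
rewrite -(ler_pXn2r (n := 2)) ?nnegrE ?addr_ge0 ?divr_ge0 ?sqr_ge0// sq.
have : 0 <= (s ^+ 2 / 2) ^+ 2 by rewrite sqr_ge0.
by rewrite sqrrD expr1n; lra.
Qed.

Lemma decay_lt1 : decay s < 1.
Proof.
rewrite ltrBlDr -(ltr_pXn2r (n := 2)) ?nnegrE ?addr_ge0 ?(ltW s0)// sq.
by rewrite sqrrD expr1n mul1r ltrD2r ltrDl mulrn_wgt0.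
Qed.

Lemma decay_le : decay s <= expR (- s + s ^+ 2 / 2).
Proof.
apply: le_trans (expR_ge1Dx _); rewrite /decay; have := sq_le; lra.
Qed.

(** Passing to the inverse, which is [Num.sqrt (1 + s ^+ 2) + s], reduces this lower bound to
    [1 + y <= expR y]. *)
Lemma decay_ge : expR (- s - s ^+ 2 / 2) <= decay s.
Proof.
rewrite -[leRHS]invrK -opprD expRN lef_pV2 ?posrE ?expR_gt0 ?invr_gt0 ?decay_gt0//.
rewrite decay_inv; apply: le_trans (expR_ge1Dx _); have := sq_le; lra.
Qed.

Lemma decay_rate : (1 - decay s ^+ 2) ^+ 2 / decay s ^+ 2 = 4 * s ^+ 2.
Proof.
have dn0 := lt0r_neq0 decay_gt0.
transitivity (((decay s)^-1 - decay s) ^+ 2); first by field.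
by rewrite decay_inv /decay; ring.
Qed.

End decay.

Lemma cvg_sqrtrV (R : realType) : (Num.sqrt t)^-1 @[t --> +oo] --> (0 : R).
Proof.
apply/gtr0_cvgV0.
  by near=> t; rewrite sqrtr_gt0; near: t; exact: nbhs_pinfty_gt.
apply/cvgryPge => M; near=> t.
have M0 : 0 <= Num.max M 0 by rewrite le_max lexx orbT.
have Mt : Num.max M 0 ^+ 2 <= t by near: t; apply: nbhs_pinfty_ge; exact: num_real.
apply: (@le_trans _ _ (Num.max M 0)); first by rewrite le_max lexx.
by rewrite -(ger0_norm M0) -sqrtr_sqr ler_wsqrtr.
Unshelve. all: by end_near. Qed.

(** With [s = Num.sqrt (c / t) / 2] the rate [4 * s ^+ 2] is [c / t]. The power lies between the
    exponentials of [- 2 k s - k s ^+ 2] and [- 2 k s + k s ^+ 2], where [2 k s] tends to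
    [x * Num.sqrt c] and [k s ^+ 2] to 0. *)
Lemma cvg_decay (R : realType) (x c : R) (k : R -> nat) : 0 < c ->
  (k t)%:R / Num.sqrt t @[t --> +oo] --> x ->
  (decay (Num.sqrt (c / t) / 2) ^+ 2) ^+ k t @[t --> +oo] --> expR (- (x * Num.sqrt c)).
Proof.
move=> c0 kx.
pose A (t : R) := (k t)%:R / Num.sqrt t * Num.sqrt c.
pose B (t : R) := (k t)%:R / Num.sqrt t * (c / 4 / Num.sqrt t).
have cA : A t @[t --> +oo] --> x * Num.sqrt c by apply: cvgM => //; exact: cvg_cst.
have cB : B t @[t --> +oo] --> (0 : R).
  rewrite -(mulr0 x); apply: cvgM => //; rewrite -(mulr0 (c / 4)).
  apply: cvgM; first exact: cvg_cst.
  exact: cvg_sqrtrV.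
have up : expR (- A t + B t) @[t --> +oo] --> expR (- (x * Num.sqrt c)).
  rewrite -[X in expR X]addr0; apply: (cvg_comp _ expR); last exact: continuous_expR.
  by apply: cvgD => //; exact: cvgN.
have lo : expR (- A t - B t) @[t --> +oo] --> expR (- (x * Num.sqrt c)).
  rewrite -[X in expR X]subr0; apply: (cvg_comp _ expR); last exact: continuous_expR.
  by apply: cvgB => //; exact: cvgN.
apply: (squeeze_cvgr _ lo up); near=> t.
have t0 : 0 < t by near: t; exact: nbhs_pinfty_gt.
set s := Num.sqrt (c / t) / 2.
have s0 : 0 < s by rewrite divr_gt0// sqrtr_gt0 divr_gt0.
have sE : s = Num.sqrt c / Num.sqrt t / 2.
  by rewrite /s sqrtrM ?(ltW c0)// sqrtrV ?(ltW t0).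
have s2 : s ^+ 2 = c / 4 / t.
  rewrite /s exprMn sqr_sqrtr ?divr_ge0 ?ltW// exprVn (_ : 2 ^+ 2 = 4); last by ring.
  by field; rewrite gt_eqF.
have t2 : Num.sqrt t ^+ 2 = t by rewrite sqr_sqrtr// ltW.
have st0 : 0 < Num.sqrt t by rewrite sqrtr_gt0.
have AE : A t = (2 * k t)%:R * s.
  have aux (K a b : R) : b != 0 -> K / b * a = 2 * K * (a / b / 2).
    by move=> b0; field.
  by rewrite natrM sE; apply: aux; rewrite gt_eqF.
have BE : B t = (2 * k t)%:R * (s ^+ 2 / 2).
  have aux (K b : R) : b != 0 -> K / b * (c / 4 / b) = 2 * K * (c / 4 / b ^+ 2 / 2).
    by move=> b0; field.
  rewrite natrM s2 (_ : c / 4 / t = c / 4 / Num.sqrt t ^+ 2); last by rewrite t2.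
  by apply: aux; rewrite gt_eqF.
have d0 := decay_gt0 s0.
rewrite -exprM AE BE -mulrN -mulrDr -mulrBr !expRM_natl; apply/andP; split.
  by rewrite lerXn2r ?nnegrE ?expR_ge0 ?(ltW d0)// decay_ge.
by rewrite lerXn2r ?nnegrE ?expR_ge0 ?(ltW d0)// decay_le.
Unshelve. all: by end_near. Qed.

(** Countably many events [top x] fix the position of the leader. Off their union [leader_pos] has
    its default value 0, and the type is read at site 0. *)
Lemma measurable_leader_type d (T : measurableType d) (e : T -> config) (i : int) :
  (forall x c, measurable [set w | e w x = c]) ->
  measurable [set w | leader_type (e w) = i].
Proof.
move=> me.
pose val x : set T := [set w | odflt 0 (e w x) = i].
have mval x : measurable (val x).
  rewrite (_ : val x = [set w | e w x = Some i] `|`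
      ([set w | e w x = None] `&` [set w | 0 = i])).
    apply: measurableU => //; apply: measurableI => //.
    have [->|i0] := eqVneq i 0.
      by rewrite (_ : mkset _ = setT)//; apply/seteqP; split.
    rewrite (_ : mkset _ = set0)//; apply/seteqP; split => // w /= i0'.
    by rewrite -i0' eqxx in i0.
  apply/seteqP; split => w; rewrite /val/=.
    by case: (e w x) => [j|] /= ->; [left|right].
  by case=> [->|[-> <-]].
pose top x : set T := [set w | e w x <> None] `&`
  \bigcap_(y in [set y | x < y]) [set w | e w y = None].
have mtop x : measurable (top x).
  apply: measurableI; first exact: (measurableC (me x None)).
  by apply: measurable_bigcap_int => y _.
have topP x w : top x w <-> e w x <> None /\ forall y, e w y <> None -> y <= x.
  split=> [[ex ey]|[ex ey]]; split => // y.
    by move=> ney; rewrite leNgt; apply/negP => /ey.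
  by move=> /= xy; apply: contrapT => /ey; rewrite leNgt xy.
rewrite (_ : mkset _ = (\bigcup_x (top x `&` val x)) `|`
    ((~` \bigcup_x top x) `&` val 0)).
  apply: measurableU; first by apply: measurable_bigcup_int => x; exact: measurableI.
  by apply: measurableI => //; apply/measurableC/measurable_bigcup_int.
have lp x w : top x w -> leader_pos (e w) = x.
  move=> /topP [ex xmax]; apply: xget_unique => // y [ey ymax].
  by apply/eqP; rewrite eq_le xmax// ymax.
apply/seteqP; split => w /=.
  have [[x tx]|ntop] := pselect (exists x, top x w).
    by rewrite /leader_type (lp _ _ tx) => vx; left; exists x.
  rewrite /leader_type (_ : leader_pos (e w) = 0).
    by move=> v0; right; split => // -[x _ tx]; apply: ntop; exists x.
  rewrite /leader_pos; case: xgetP => // y _ /= hy; exfalso; apply: ntop.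
  by exists y; apply/topP.
case=> [[x _ [tx]]|[nt]]; first by rewrite /leader_type (lp _ _ tx).
rewrite /leader_type (_ : leader_pos (e w) = 0)//.
rewrite /leader_pos; case: xgetP => // y _ /= hy; exfalso; apply: nt.
by exists y => //; apply/topP.
Qed.

Lemma measurable_intr d (T : measurableType d) (R : realType) (f : T -> int) :
  (forall i, measurable [set w | f w = i]) ->
  measurable_fun [set: T] (fun w => (f w)%:~R : R).
Proof.
move=> mf _ B mB; rewrite setTI.
rewrite (_ : _ @^-1` _ = \bigcup_i ([set w | f w = i] `&` [set w | B (i%:~R : R)])).
  apply: measurable_bigcup_int => i; apply: measurableI => //.
  have [Bi|Bi] := pselect (B (i%:~R : R)).
    by rewrite (_ : mkset _ = setT)//; apply/seteqP; split.
  by rewrite (_ : mkset _ = set0)//; apply/seteqP; split.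
apply/seteqP; split => [w Bw|w [i _ [/= <-]]//].
by exists (f w).
Qed.

Lemma ae_eq_probability d (T : measurableType d) (R : realType)
    (P : probability T R) (A B : set T) :
  measurable A -> measurable B -> {ae P, forall w, A w <-> B w} -> P A = P B.
Proof.
move=> mA mB AB.
rewrite -(setIT A) -(setIT B) -!integral_indic//.
apply: ge0_ae_eq_integral => //.
- exact/measurable_EFinP/measurable_indic.
- exact/measurable_EFinP/measurable_indic.
- by apply: filterS AB => w ABw _; rewrite !indicE; congr (nat_of_bool _)%:R%:E;
    apply/idP/idP; rewrite !inE => /ABw.
Qed.

(** * The limiting distribution function *)

Section limit_cdf.
Variable R : realType.
Let G (x : R) : R := fine (limit_prob (R := R) `]-oo, x]).

Let Qfin (A : set (measurableTypeR R)) : measurable A ->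
  limit_prob (R := R) A \is a fin_num.
Proof. by move=> mA; exact: fin_num_measure. Qed.

Let G_itv (a b : R) : a <= b -> G b = G a + fine (limit_prob (R := R) `]a, b]).
Proof.
move=> ab; rewrite /G -fineD ?Qfin//; congr fine.
rewrite -measureU//.
  congr (limit_prob _); apply/esym; rewrite -itv_bndbnd_setU ?bnd_simp//.
apply/seteqP; split => // z []; rewrite /= !in_itv/= => za /andP[].
by rewrite ltNge za.
Qed.

Lemma limit_cdf_le (a b : R) : a <= b -> G a <= G b.
Proof. by move=> ab; rewrite (G_itv ab) lerDl fine_ge0. Qed.

Lemma limit_cdf_lip (a b : R) : a <= b -> G b <= G a + (b - a).
Proof.
move=> ab; rewrite (G_itv ab) lerD2l -lee_fin fineK ?Qfin//.
exact: limit_prob_itv.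
Qed.

Lemma limit_cdf_gt (a : R) : fine (limit_prob (R := R) `]a, +oo[) = 1 - G a.
Proof.
rewrite -setCitvl probability_setC//= fineB// ?Qfin//.
Qed.

Lemma limit_cdf0 (x : R) : x <= 0 -> G x = 0.
Proof.
move=> x0; apply/eqP; rewrite eq_le fine_ge0// andbT.
apply/ler_addgt0Pr => e e0; rewrite add0r.
have Ne : G (- e) = 0 by rewrite /G limit_prob_Ny0// oppr_lt0.
have [ex|xe] := leP (- e) x; last first.
  by rewrite (le_trans (limit_cdf_le (ltW xe)))// Ne ltW.
by have := limit_cdf_lip ex; rewrite Ne; lra.
Qed.

End limit_cdf.

Lemma dist_bracket (R : realType) (p q1 q2 g1 g g2 c d1 d2 : R) :
  p <= q1 + c -> q1 <= 1 - g1 -> g <= g1 + d1 ->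
  q2 <= p + c -> 1 - g2 <= q2 -> g2 <= g + d2 ->
  0 <= d1 -> 0 <= d2 -> `|p - (1 - g)| <= c + d1 + d2.
Proof. by move=> *; rewrite ler_distl; apply/andP; split; lra. Qed.

Section leader_law.
Context d (T : measurableType d) (R : realType) (P : probability T R).
Variable tau : int -> nat -> {RV P >-> R}.
Hypothesis tau_exp : exponential_clocks tau.
Variable x : R.
Hypothesis x0 : 0 < x.

(** The least integer strictly above [x * Num.sqrt t], so that a type is at most [x * Num.sqrt t]
    exactly when it is not at least [k t]. *)
Let k (t : R) : nat := (Num.truncn (x * Num.sqrt t)).+1.
Let M t := met tau (k t).
Let H t := meeting_time tau (k t).
(** The value 0 off [M t] stands for an infinite meeting time. The absolute value provides the bound
    by 1 at every [t], as [moments_step] asks. *)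
Let Y (u t : R) : T -> R := (fun w => expR (- (u / `|t|) * H t w)) \_ (M t).
Let Z (u z : R) : R := expR (- (Num.sqrt u * x / z) ^+ 2).
Let G (y : R) : R := fine (limit_prob (R := R) `]-oo, y]).

Let cvg_k : (k t)%:R / Num.sqrt t @[t --> +oo] --> x.
Proof.
have up : x + (Num.sqrt t)^-1 @[t --> +oo] --> x + 0.
  by apply: cvgD; [exact: cvg_cst|exact: cvg_sqrtrV].
rewrite addr0 in up.
apply: (squeeze_cvgr _ (cvg_cst x) up); near=> t.
have t0 : 0 < t by near: t; exact: nbhs_pinfty_gt.
have s0 : 0 < Num.sqrt t by rewrite sqrtr_gt0.
have /andP[k1 k2] : (Num.truncn (x * Num.sqrt t))%:R <= x * Num.sqrt t
    < (Num.truncn (x * Num.sqrt t)).+1%:R.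
  by apply: truncn_itv; rewrite mulr_ge0// ltW.
rewrite ler_pdivlMr// (ltW k2)/= ler_pdivrMr// mulrDl mulVf ?gt_eqF//.
by rewrite -natr1 lerD2r.
Unshelve. all: by end_near. Qed.

Let mY u t : measurable_fun [set: T] (Y u t).
Proof.
apply/(measurable_restrictT _ (measurable_met _ _)).
apply: measurableT_comp => //; apply: measurable_funM => //.
exact: measurable_meeting_time.
Qed.

Let Y_ge0 u t w : 0 <= Y u t w.
Proof. by rewrite /Y patchE; case: ifP => // _; exact: expR_ge0. Qed.

Let Y_le1 u t w : 0 < u -> Y u t w <= 1.
Proof.
move=> u0; rewrite /Y patchE; case: ifP => // _.
by rewrite -expR0 ler_expR mulNr oppr_le0 mulr_ge0 ?meeting_time_ge0// divr_ge0// ltW.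
Qed.

Let mZ u : measurable_fun [set: R] (Z u).
Proof.
apply: measurableT_comp => //; apply: measurableT_comp => //.
by apply: measurable_funX; apply: measurable_funM => //; exact: measurable_invr.
Qed.

(** The moment of order [n.+1] of [Y u t] is the transform of [H t] at [c / t] with [c = n.+1 * u];
    the corresponding moment of [Z u] is the transform of the limit law at [x * Num.sqrt c]. *)
Let cvg_moments u n : 0 < u ->
  \int[P]_w (Y u t w ^+ n.+1) @[t --> +oo] -->
  \int[limit_prob (R := R)]_z (Z u z ^+ n.+1).
Proof.
move=> u0; pose c := n.+1%:R * u.
have c0 : 0 < c by rewrite mulr_gt0.
have -> : \int[limit_prob (R := R)]_z (Z u z ^+ n.+1) = expR (- (x * Num.sqrt c)).
  have xc0 : 0 < x * Num.sqrt c by rewrite mulr_gt0// sqrtr_gt0.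
  rewrite /Rintegral; transitivity (fine (\int[limit_prob (R := R)]_z
      (expR (- (x * Num.sqrt c / z) ^+ 2))%:E)%E); last first.
    by rewrite laplace_limit_prob.
  congr fine; apply: eq_integral => z _; rewrite /Z -expRM_natl; congr (expR _)%:E.
  rewrite mulrN; congr (- _); rewrite !exprMn !sqr_sqrtr ?ltW// /c.
  by ring.
apply: cvg_trans (cvg_decay c0 cvg_k); apply: near_eq_cvg; near=> t.
have t0 : 0 < t by near: t; exact: nbhs_pinfty_gt.
have s0 : 0 < Num.sqrt (c / t) / 2 by rewrite divr_gt0// sqrtr_gt0 divr_gt0.
have q0 : 0 < decay (Num.sqrt (c / t) / 2) ^+ 2 by rewrite exprn_gt0// decay_gt0.
have q1 : decay (Num.sqrt (c / t) / 2) ^+ 2 < 1.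
  by rewrite exprn_ilt1// ?decay_lt1// ltW// decay_gt0.
have := laplace_meeting_time tau_exp (k t) q0 q1.
rewrite decay_rate// => /(congr1 fine) /= <-.
rewrite /Rintegral [in LHS]integral_mkcond; congr fine; apply: eq_integral => w _.
rewrite /Y !patchE; case: ifPn => _; last by rewrite expr0n.
rewrite -expRM_natl; congr (expR _)%:E; rewrite -/(H t w).
rewrite exprMn sqr_sqrtr ?divr_ge0 ?ltW// ger0_norm ?ltW// /c.
by field; rewrite gt_eqF.
Unshelve. all: by end_near. Qed.

Let Y_geE u t w : 0 < u -> 0 < t -> expR (- u) <= Y u t w <-> M t w /\ H t w <= t.
Proof.
move=> u0 t0; rewrite /Y patchE; case: ifPn => [|/negP]; rewrite inE => Mw.
  rewrite ler_expR mulNr lerN2 gtr0_norm// mulrAC ler_pdivrMr// ler_pM2l//.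
  by split=> [|[]].
by rewrite leNgt expR_gt0; split=> // -[].
Qed.

Let Y_geset u t : 0 < u -> 0 < t ->
  [set w | expR (- u) <= Y u t w] = [set w | M t w /\ H t w <= t].
Proof. by move=> u0 t0; apply/seteqP; split => w /= /Y_geE; apply. Qed.

Let ln2_gt0 : 0 < ln 2 :> R. Proof. by rewrite ln_gt0// ltr1n. Qed.

Let expR_ln2 : expR (- ln 2) = 2^-1 :> R.
Proof. by rewrite expRN lnK// posrE. Qed.

(* [moments_step] only separates the values on the two sides of [1 / 2], hence
   the exponents [kp * ln 2] and [ln 2 / kp], which place the value
   [expR (- u)] of [Y u t] at [H t w = t] just above or just below [1 / 2]. *)
Section kappa.
Variable kp : R.
Hypotheses (kp0 : 0 < kp) (kp1 : kp < 1).

Let y1h : expR (- (ln 2 / kp)) < 2^-1 :> R.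
Proof. by rewrite -expR_ln2 ltr_expR ltrN2 ltr_pdivlMr// gtr_pMr. Qed.

Let y2h : 2^-1 < expR (- (kp * ln 2)) :> R.
Proof. by rewrite -expR_ln2 ltr_expR ltrN2 gtr_pMl. Qed.

Let mZset u y : measurable [set z | y <= Z u z].
Proof. exact: measurable_set_ler. Qed.

Let sq_sqrtr (u z : R) : 0 < u ->
  (Num.sqrt u * x / z) ^+ 2 = u * (x / z) ^+ 2.
Proof. by move=> u0; rewrite -mulrA exprMn sqr_sqrtr// ltW. Qed.

Let Zle1 u z : Z u z <= 1.
Proof. by rewrite -expR0 ler_expR oppr_le0 sqr_ge0. Qed.

Let Qup : fine (limit_prob (R := R) [set z | expR (- (ln 2 / kp)) <= Z (kp * ln 2) z])
  <= 1 - G (kp ^+ 2 * x).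
Proof.
(* For [z > 0] the event amounts to [kp * x <= z]. The extra factor [kp] in [a] makes room for the
   strict inequality [a < z], and the half line [z <= 0] has probability 0. *)
set S := [set z | _]; pose a := kp ^+ 2 * x.
have a0 : 0 < a by rewrite mulr_gt0// exprn_gt0.
have mS : measurable S by exact: mZset.
have QS : (limit_prob (R := R) S <=
    limit_prob (R := R) `]-oo, 0%R] + limit_prob (R := R) `]a, +oo[)%E.
  apply: (@le_trans _ _ (limit_prob (R := R) (`]-oo, 0%R] `|` `]a, +oo[))); last first.
    exact: measureU2.
  apply: le_measure; rewrite ?inE//; first exact: measurableU.
  move=> z; rewrite /S/= !in_itv/= andbT ler_expR lerN2 => zS.
  have [z0|z0] := leP z 0; [by left|right]; rewrite ltNge; apply/negP => za.
  have xz0 : 0 < x / z by rewrite divr_gt0.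
  have r1 : 1 <= kp * (kp * (x / z)) by rewrite !mulrA ler_pdivlMr// mul1r -expr2.
  have r2 : 1 < kp * (x / z).
    by apply: le_lt_trans r1 _; rewrite gtr_pMl// mulr_gt0.
  move: zS; rewrite sq_sqrtr ?mulr_gt0// leNgt => /negP; apply.
  have -> : kp * ln 2 * (x / z) ^+ 2 = (kp * (x / z)) ^+ 2 * (ln 2 / kp).
    by field; rewrite !gt_eqF.
  by rewrite ltr_pMl ?divr_gt0// exprn_egt1.
have -> : 1 - G a = G 0 + fine (limit_prob (R := R) `]a, +oo[).
  have G0 : G 0 = 0 by exact: limit_cdf0.
  by rewrite limit_cdf_gt G0 add0r.
rewrite -fineD ?fin_num_measure//; apply: fine_le QS.
  exact: fin_num_measure.
by rewrite fin_numD !fin_num_measure.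
Qed.

Let Qlo : 1 - G (x / kp) <=
  fine (limit_prob (R := R) [set z | expR (- (kp * ln 2)) <= Z (ln 2 / kp) z]).
Proof.
rewrite -limit_cdf_gt; apply: fine_le; rewrite ?fin_num_measure//; first exact: mZset.
apply: le_measure; rewrite ?inE//; first exact: mZset.
move=> z; rewrite /= in_itv/= andbT => xz.
have z0 : 0 < z by apply: lt_trans xz; rewrite divr_gt0.
have xz0 : 0 <= x / z by rewrite divr_ge0// ltW.
have r1 : x / z <= kp.
  by rewrite ler_pdivrMr// mulrC -ler_pdivrMr// ltW.
rewrite ler_expR lerN2 sq_sqrtr ?divr_gt0//.
have -> : kp * ln 2 = ln 2 / kp * kp ^+ 2 by field; rewrite gt_eqF.
by rewrite ler_pM2l ?divr_gt0// lerXn2r// nnegrE ltW.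
Qed.

(** With [u = kp * ln 2] the event [H t <= t] is [y2 <= Y], which [moments_step] bounds from above;
    with [u = ln 2 / kp] it is [y1 <= Y], which is bounded from below. The last two error terms are
    the Lipschitz cost of replacing [kp ^+ 2 * x] and [x / kp] by [x]. *)
Lemma meeting_law_kappa (e : R) : 0 < e -> \forall t \near +oo,
  `|fine (P [set w | M t w /\ H t w <= t]) - (1 - G x)| <=
  e + (x - kp ^+ 2 * x) + (x / kp - x).
Proof.
move=> e0.
have y10 : 0 <= expR (- (ln 2 / kp)) :> R by exact: expR_ge0.
have u1 : 0 < kp * ln 2 :> R by rewrite mulr_gt0.
have u2 : 0 < ln 2 / kp :> R by rewrite divr_gt0.
have FG : Filter (pinfty_nbhs R) by exact: _.
have h1 := @moments_step R (pinfty_nbhs R) FG _ _ _ P _ _ (limit_prob (R := R)) (Y (kp * ln 2))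
  (Z (kp * ln 2)) _ _ e (@mY _) (@Y_ge0 _) (fun t w => @Y_le1 _ t w u1) (@mZ _)
  (fun z => expR_ge0 _) (Zle1 _) (fun n => @cvg_moments _ n u1) y10 y1h y2h e0.
have h2 := @moments_step R (pinfty_nbhs R) FG _ _ _ P _ _ (limit_prob (R := R)) (Y (ln 2 / kp))
  (Z (ln 2 / kp)) _ _ e (@mY _) (@Y_ge0 _) (fun t w => @Y_le1 _ t w u2) (@mZ _)
  (fun z => expR_ge0 _) (Zle1 _) (fun n => @cvg_moments _ n u2) y10 y1h y2h e0.
have h3 := @nbhs_pinfty_gt R 0 (num_real 0).
apply: filterS3 h1 h2 h3 => t [a1 _] [_ a2] t0.
rewrite Y_geset// in a1; rewrite Y_geset// in a2.
have kp2 : kp ^+ 2 <= 1 by rewrite exprn_ile1// ltW.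
have b1 : kp ^+ 2 * x <= x by rewrite ler_piMl// ltW.
have b2 : x <= x / kp by rewrite ler_pdivlMr// ler_piMr// ltW.
by apply: (dist_bracket a1 Qup (limit_cdf_lip b1) a2 Qlo
  (limit_cdf_lip b2)); rewrite subr_ge0.
Qed.

End kappa.

Lemma meeting_law (e : R) : 0 < e -> \forall t \near +oo,
  `|fine (P [set w | M t w /\ H t w <= t]) - (1 - G x)| <= e.
Proof.
(* With [kp = 1 - dl] and [dl <= 1 / 2], each Lipschitz term is at most [2 * (dl * x) <= e / 4],
   which leaves [e / 2] for the moments. *)
move=> e0; pose dl := Num.min 2^-1 (e / (8 * x)).
have x8 : 0 < 8 * x by rewrite mulr_gt0.
have dl0 : 0 < dl by rewrite lt_min invr_gt0 ltr0n divr_gt0.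
have dl1 : dl <= 2^-1 by rewrite ge_min lexx.
have dl2 : dl * x <= e / 8.
  have : dl * (8 * x) <= e by rewrite -ler_pdivlMr// ge_min lexx orbT.
  by rewrite mulrCA => dle; rewrite ler_pdivlMr// mulrC.
have kp0 : 0 < 1 - dl by lra.
have kp1 : 1 - dl < 1 by lra.
have e2 : 0 < e / 2 by rewrite divr_gt0.
have := meeting_law_kappa kp0 kp1 e2; apply: filterS => t /le_trans; apply.
have b1 : x - (1 - dl) ^+ 2 * x <= 2 * (dl * x).
  have : 0 <= dl ^+ 2 * x by rewrite mulr_ge0 ?sqr_ge0// ltW.
  lra.
have b2 : x / (1 - dl) - x <= 2 * (dl * x).
  rewrite lerBlDr ler_pdivrMr//.
  have : 0 <= dl * x * (1 - 2 * dl).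
    by rewrite mulr_ge0 ?(ltW (mulr_gt0 dl0 x0))//; lra.
  lra.
lra.
Qed.

Variable eta : R -> T -> config.
Hypothesis eta_TASEP : multi_type_TASEP tau step_config eta.

Lemma ae_leader_type_ge (n : nat) (t : R) : 0 <= t ->
  {ae P, forall w, n%:Z <= leader_type (eta t w) <->
    met tau n w /\ meeting_time tau n w <= t}.
Proof.
move=> t0; apply: filterS2 (ae_clock_good tau_exp) eta_TASEP.2.
move=> w [wpos wunb wsil] [w0 wgc].
have fgt0 y m : 0 < clocks tau w y m by exact: wpos.
have funb y u : exists m, u < arrival (clocks tau w y) m.+1 by exact: wunb.
have fsil u y : exists2 z, y < z & u < clocks tau w z 0%N by exact: wsil.
have far y : exists m, t < lead (clocks tau w) (y + m)%N.
  exact: (lead_unbounded fgt0 funb fsil).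
rewrite meeting_time_le (meet_beforeP n far).
exact: (leader_type_ge fgt0 funb fsil wgc w0).
Qed.

Lemma measurable_leader (t : R) : 0 <= t ->
  measurable_fun [set: T] (fun w => (leader_type (eta t w))%:~R / Num.sqrt t).
Proof.
move=> t0; apply: measurable_funM => //; apply: measurable_intr => i.
by apply: measurable_leader_type => y c; exact: eta_TASEP.1.
Qed.

Lemma leader_cdf (t : R) : 0 < t ->
  fine (P [set w | (leader_type (eta t w))%:~R / Num.sqrt t <= x]) =
  1 - fine (P [set w | M t w /\ H t w <= t]).
Proof.
move=> t0; have st0 : 0 < Num.sqrt t by rewrite sqrtr_gt0.
have mB : measurable [set w | M t w /\ H t w <= t].
  rewrite -(Y_geset (u := 1))//; exact: measurable_set_ler.
transitivity (fine (P (~` [set w | M t w /\ H t w <= t]))).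
  congr fine; apply: ae_eq_probability.
  - by apply: measurable_set_ler => //; exact: measurable_leader (ltW t0).
  - exact: measurableC.
  apply: filterS (ae_leader_type_ge (k t) (ltW t0)) => w /= <-.
  rewrite ler_pdivrMr// -[X in _ <-> ~ X]/(is_true _).
  have /andP[k1 k2] : (Num.truncn (x * Num.sqrt t))%:R <= x * Num.sqrt t
      < (Num.truncn (x * Num.sqrt t)).+1%:R.
    by apply: truncn_itv; rewrite mulr_ge0// ltW.
  split=> [Lx|/negP]; last first.
    rewrite -ltNge => Lk.
    have Ln : leader_type (eta t w) <= (Num.truncn (x * Num.sqrt t))%:Z.
      by move: Lk; rewrite /k; lia.
    by apply: le_trans k1; rewrite [leRHS]pmulrn ler_int.
  apply/negP; rewrite -ltNge -(ltr_int R); exact: le_lt_trans k2.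
rewrite probability_setC// fineB// fin_num_measure//.
Qed.

End leader_law.

Unset Implicit Arguments.

Theorem theorem1p1 (d : measure_display) (T : measurableType d) (R : realType)
    (P : probability T R) (tau : int -> nat -> {RV P >-> R})
    (eta : R -> T -> config) :
  exponential_clocks tau ->
  multi_type_TASEP tau step_config eta ->
  cvg_in_distribution P
    (fun t w => (leader_type (eta t w))%:~R / Num.sqrt t)
    (@limit_prob R).
Proof.
move=> tau_exp eta_TASEP; split.
  near=> t; apply: (measurable_leader eta_TASEP).
  by near: t; exact: nbhs_pinfty_ge.
move=> x _; pose G (y : R) : R := fine (limit_prob (R := R) `]-oo, y]).
pose p y t := fine (P [set w | (leader_type (eta t w))%:~R / Num.sqrt t <= y]).
have near_p (y e : R) : 0 < y -> 0 < e -> \forall t \near +oo, `|G y - p y t| <= e.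
  move=> y0 e0; have := meeting_law tau_exp y0 e0.
  apply: filterS2 (@nbhs_pinfty_gt R 0 (num_real 0)) => t t0.
  rewrite /p (leader_cdf tau_exp y0 eta_TASEP t0) -/(G y); set F := fine _.
  by have -> : F - (1 - G y) = G y - (1 - F) by ring.
have mE y t : 0 <= t ->
    measurable [set w | (leader_type (eta t w))%:~R / Num.sqrt t <= y].
  by move=> t0; apply: measurable_set_ler => //; exact: (measurable_leader eta_TASEP).
have cvgp : p x t @[t --> +oo] --> G x.
  (* The meeting argument covers [x > 0]. For [x <= 0] the limit is 0, and [p x t] is at most
     [p (e / 2) t], which is eventually within [e / 2] of [G (e / 2) <= e / 2]. *)
  apply/cvgrPdist_le => e e0; have [x0|x0] := ltP 0 x; first exact: near_p.
  have e2 : 0 < e / 2 by rewrite divr_gt0.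
  have := near_p _ _ e2 e2.
  apply: filterS2 (@nbhs_pinfty_gt R 0 (num_real 0)) => t t0.
  have -> : G x = 0 by exact: limit_cdf0.
  have Ge : G (e / 2) <= e / 2.
    have := limit_cdf_lip (ltW e2); rewrite (limit_cdf0 (lexx (0 : R))) add0r subr0.
    exact.
  have p0 : 0 <= p x t by exact: fine_ge0.
  have pe : p x t <= p (e / 2) t.
    apply: fine_le; rewrite ?fin_num_measure//; try exact: mE (ltW t0).
    apply: le_measure; rewrite ?inE; try exact: mE (ltW t0).
    by move=> w /= /le_trans; apply; rewrite (le_trans x0)// ltW.
  by rewrite ler_distlC sub0r normrN (ger0_norm p0) => /andP[_ h]; lra.
have GE : (G x)%:E = limit_prob (R := R) `]-oo, x].
  by rewrite /G fineK// fin_num_measure.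
suff : P [set w | (leader_type (eta t w))%:~R / Num.sqrt t <= x] @[t --> +oo] --> (G x)%:E.
  by rewrite GE.
apply/fine_cvgP; split; last exact: cvgp.
near=> t; apply: fin_num_measure; apply: mE.
by near: t; exact: nbhs_pinfty_ge.
Unshelve. all: by end_near. Qed.
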